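(* Let $\Omega_1\subset\mathbb{R}^{d_1}$, $\Omega_2\subset\mathbb{R}^{d_2}$, $\Omega=\Omega_1\times\Omega_2$, $\mu_2^{\mathrm d}\in\mathfrak{M}(\Omega_2)$, $c_{\mathrm d}\in W^{1,p}(\Omega)$ with $p>d_1+d_2$, and $\mathcal{J}\colon\mathfrak{M}(\Omega)\times\mathfrak{M}(\Omega_1)\to\mathbb{R}$ satisfy the standing assumptions listed in the context. Then the bilevel Kantorovich problem $$ \inf_{\pi,\mu_1}\ \mathcal{J}(\pi,\mu_1)\quad\text{s.t.}\quad \begin{cases} \mu_1\in\mathfrak{M}(\Omega_1),\quad \mu_1\ge 0,\quad \|\mu_1\|_{\mathfrak{M}(\Omega_1)}=1,\\[2pt] \pi\in\operatorname{argmin}\Big\{\int_\Omega c_{\mathrm d}\,\mathrm{d}\varphi \colon \varphi\in\Pi(\mu_1,\mu_2^{\mathrm d}),\ \varphi\ge 0\Big\} \end{cases} $$ has at least one globally optimal solution, i.e., there exists a feasible pair $(\bar\pi,\bar\mu_1)\in\mathfrak{M}(\Omega)\times\mathfrak{M}(\Omega_1)$ with $\mathcal{J}(\bar\pi,\bar\mu_1)\le\mathcal{J}(\pi,\mu_1)$ for all feasible pairs $(\pi,\mu_1)$.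
   Context: Domains: $d_1,d_2\in\mathbb{N}$; $\Omega_1\subset\mathbb{R}^{d_1}$ and $\Omega_2\subset\mathbb{R}^{d_2}$ are compact connected sets with non-empty interior; $\Omega:=\Omega_1\times\Omega_2$ coincides with the closure of its interior and has a Lipschitz boundary. Measures: for a compact set $X$, $\mathfrak{M}(X)$ is the space of signed regular Borel measures on $X$ with the total variation norm $\|\mu\|_{\mathfrak{M}(X)}=|\mu|(X)$; weak-$*$ convergence is with respect to the duality with $C(X)$. For $\mu_1\in\mathfrak{M}(\Omega_1)$, $\mu_2\in\mathfrak{M}(\Omega_2)$, $$\Pi(\mu_1,\mu_2):=\{\pi\in\mathfrak{M}(\Omega)\colon {P_1}_\#\pi=\mu_1,\ {P_2}_\#\pi=\mu_2\},$$ where $P_i\colon\Omega\ni(x_1,x_2)\mapsto x_i\in\Omega_i$ and ${P_i}_\#\pi=\pi\circ P_i^{-1}$. Data: $\mu_2^{\mathrm d}\in\mathfrak{M}(\Omega_2)$ is fixed with $\mu_2^{\mathrm d}\ge 0$ and $\|\mu_2^{\mathrm d}\|_{\mathfrak{M}(\Omega_2)}=1$. The cost $c_{\mathrm d}$ belongs to $W^{1,p}(\Omega)$ (the Sobolev space on the interior of $\Omega$) with $p>d_1+d_2$, and is identified with its continuous representative in $C(\Omega)$. The functional $\mathcal{J}\colon\mathfrak{M}(\Omega)\times\mathfrak{M}(\Omega_1)\to\mathbb{R}$ is lower semicontinuous with respect to weak-$*$ convergence, i.e., $\mathcal{J}(\pi,\mu_1)\le\liminf_{k\to\infty}\mathcal{J}(\pi_k,\mu_1^k)$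 whenever $\pi_k\rightharpoonup^*\pi$ in $\mathfrak{M}(\Omega)$ and $\mu_1^k\rightharpoonup^*\mu_1$ in $\mathfrak{M}(\Omega_1)$. *)

(* Defs.v *)
From HB Require Import structures.
From mathcomp Require Import all_boot all_order all_algebra.
From mathcomp Require Import all_classical all_reals all_analysis.

Set Implicit Arguments.
Unset Strict Implicit.
Unset Printing Implicit Defensive.

Import Order.TTheory GRing.Theory Num.Theory.
Import numFieldNormedType.Exports.

Local Open Scope classical_set_scope.
Local Open Scope ring_scope.

(* R^n is 'rV[R]_n for R : realType; its topology is that of the sup norm, and
   its sigma-algebra is the Borel one. *)

Definition borel_display : measure_display.
Proof. exact: default_measure_display. Qed.

Section borel_matrix.
Variables (R : realType) (m n : nat).

Let borel_set0 : <<s @open 'M[R]_(m, n) >> set0.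
Proof. exact: sigma_algebra0. Qed.

Let borel_setC (A : set 'M[R]_(m, n)) :
  <<s @open 'M[R]_(m, n) >> A -> <<s @open 'M[R]_(m, n) >> (~` A).
Proof. exact: sigma_algebraC. Qed.

Let borel_bigcup (F : (set 'M[R]_(m, n))^nat) :
  (forall k, <<s @open 'M[R]_(m, n) >> (F k)) ->
  <<s @open 'M[R]_(m, n) >> (\bigcup_k F k).
Proof. exact: sigma_algebra_bigcup. Qed.

HB.instance Definition _ := @isMeasurable.Build borel_display 'M[R]_(m, n)
  <<s @open 'M[R]_(m, n) >> borel_set0 borel_setC borel_bigcup.

End borel_matrix.

Section signed_measures.
Variables (R : realType) (n : nat).
Implicit Types (nu : {charge set 'rV[R]_n -> \bar R}) (X : set 'rV[R]_n).

Lemma exists_hahn nu : exists PN : set 'rV[R]_n * set 'rV[R]_n,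
  hahn_decomposition nu PN.1 PN.2.
Proof. by have [P [N nuPN]] := Hahn_decomposition nu; exists (P, N). Qed.

(* Any Hahn decomposition will do: jordan_pos, jordan_neg and charge_variation
   do not depend on it on measurable sets. *)
Definition hahn nu := projT2 (cid (exists_hahn nu)).

Definition total_variation nu : {measure set 'rV[R]_n -> \bar R} :=
  charge_variation (hahn nu).

Definition charge_integral nu X (f : 'rV[R]_n -> R) : R :=
  \int[jordan_pos (hahn nu)]_(x in X) f x
  - \int[jordan_neg (hahn nu)]_(x in X) f x.

Definition regular_charge nu :=
  forall A, measurable A -> forall e : R, 0 < e ->
  exists K U : set 'rV[R]_n, [/\ compact K, open U, K `<=` A, A `<=` U &
    (total_variation nu (U `\` K) < e%:E)%E].

(* The space M(X): a signed Borel measure on X is encoded as a charge on the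
   Borel sets of R^n that vanishes on the Borel sets disjoint from X. *)
Record signed_measure X := SignedMeasure {
  charge_of :> {charge set 'rV[R]_n -> \bar R};
  charge_of_carried : forall A, measurable A -> A `&` X = set0 ->
    charge_of A = 0%E;
  charge_of_regular : regular_charge charge_of }.

Definition tv_norm X (mu : signed_measure X) : \bar R := total_variation mu X.

Definition nonneg X (mu : signed_measure X) :=
  forall A, measurable A -> (0 <= mu A)%E.

Definition integral_on X (mu : signed_measure X) (f : 'rV[R]_n -> R) : R :=
  charge_integral mu X f.

(* C(X) is represented by the functions on R^n whose restriction to X is
   continuous; integral_on only sees their values on X. *)
Definition weak_star_cvg X (mu_ : nat -> signed_measure X)
    (mu : signed_measure X) :=
  forall f : 'rV[R]_n -> R, {within X, continuous f} ->
  integral_on (mu_ k) f @[k --> \oo] --> integral_on mu f.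

End signed_measures.

Section transport.
Variables (R : realType) (d1 d2 : nat).
Variables (O1 : set 'rV[R]_d1) (O2 : set 'rV[R]_d2).

(* R^d1 x R^d2 is identified with R^(d1 + d2); the projections P_1 and P_2 are
   then lsubmx and rsubmx, and P_i^-1(A) may be taken in R^(d1 + d2) because the
   measures on rv_prod vanish off it. *)
Definition rv_prod : set 'rV[R]_(d1 + d2) :=
  [set x | O1 (lsubmx x) /\ O2 (rsubmx x)].

Definition transport_plans (mu1 : signed_measure O1) (mu2 : signed_measure O2) :
    set (signed_measure rv_prod) :=
  [set pi | (forall A : set 'rV[R]_d1, measurable A ->
               pushforward pi (@lsubmx R 1 d1 d2) A = mu1 A) /\
            (forall A : set 'rV[R]_d2, measurable A ->
               pushforward pi (@rsubmx R 1 d1 d2) A = mu2 A)].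

Definition nonneg_plans (mu1 : signed_measure O1) (mu2 : signed_measure O2) :
    set (signed_measure rv_prod) :=
  transport_plans mu1 mu2 `&` @nonneg _ _ _.

Definition kantorovich_argmin (c : 'rV[R]_(d1 + d2) -> R)
    (mu1 : signed_measure O1) (mu2 : signed_measure O2) :
    set (signed_measure rv_prod) :=
  [set pi | nonneg_plans mu1 mu2 pi /\
            forall phi, nonneg_plans mu1 mu2 phi ->
              integral_on pi c <= integral_on phi c].

Definition bilevel_feasible (c : 'rV[R]_(d1 + d2) -> R)
    (mu2 : signed_measure O2) :
    set (signed_measure rv_prod * signed_measure O1) :=
  [set pm | [/\ nonneg pm.2, tv_norm pm.2 = 1%E &
                kantorovich_argmin c pm.2 mu2 pm.1]].

Definition weak_star_lsc
    (J : signed_measure rv_prod -> signed_measure O1 -> R) :=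
  forall (pi_ : nat -> signed_measure rv_prod) (pi : signed_measure rv_prod)
         (mu_ : nat -> signed_measure O1) (mu : signed_measure O1),
  weak_star_cvg pi_ pi -> weak_star_cvg mu_ mu ->
  ((J pi mu)%:E <= limn_einf (fun k => (J (pi_ k) (mu_ k))%:E))%E.

End transport.

(* Near each boundary point, in suitable Cartesian coordinates (y = x Q with Q
   orthogonal), D is the set of points above the graph of a Lipschitz function
   of all coordinates but the i-th. The sup norm and the Euclidean norm have the
   same Lipschitz functions. *)
Definition has_lipschitz_boundary (R : realType) (n : nat) (D : set 'rV[R]_n) :=
  forall x, (closure D `\` interior D) x ->
  exists (Q : 'M[R]_n) (i : 'I_n) (gamma : 'rV[R]_n.-1 -> R) (L : R),
    [/\ Q *m Q^T = 1%:M, L.-lipschitz gamma &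
        \forall z \near x,
          D z <-> gamma (col' i (z *m Q)) <= (z *m Q) ord0 i].

Section lebesgue_measure_rV.
Variables (R : realType) (n : nat).

(* Volume of the smallest closed box containing B (+oo if B is unbounded). *)
Definition box_volume (B : set 'rV[R]_n) : \bar R :=
  if B == set0 then 0%E else
  ereal_inf [set (\prod_(i < n) (ab.2 ord0 i - ab.1 ord0 i))%:E |
    ab in [set ab : 'rV[R]_n * 'rV[R]_n |
      (forall i, ab.1 ord0 i <= ab.2 ord0 i) /\
      B `<=` [set x | forall i, ab.1 ord0 i <= x ord0 i <= ab.2 ord0 i]]].

Lemma box_volume0 : box_volume set0 = 0%E.
Proof. by rewrite /box_volume eqxx. Qed.

Lemma box_volume_ge0 B : (0 <= box_volume B)%E.
Proof.
rewrite /box_volume; case: ifPn => // _; apply: le_ereal_inf_tmp.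
move=> _ [ab [ab1 _] <-]; rewrite lee_fin; apply: prodr_ge0 => i _.
by rewrite subr_ge0.
Qed.

(* The infimum of the total volume over countable covers: covering by Borel sets
   measured by box_volume is the same as covering by boxes. *)
Definition lebesgue_outer : set 'rV[R]_n -> \bar R := mu_ext box_volume.

HB.instance Definition _ := isOuterMeasure.Build R 'rV[R]_n lebesgue_outer
  (mu_ext0 box_volume0 box_volume_ge0) (mu_ext_ge0 box_volume_ge0)
  (le_mu_ext box_volume) (mu_ext_sigma_subadditive box_volume_ge0).

Definition lebesgue_outer_measure : {outer_measure set 'rV[R]_n -> \bar R} :=
  lebesgue_outer.

(* R^n with its Lebesgue (that is, Caratheodory) measurable sets. *)
Definition lebesgue_type := caratheodory_type lebesgue_outer_measure.
HB.instance Definition _ := Measurable.on lebesgue_type.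

Definition lebesgue_rV : {measure set lebesgue_type -> \bar R} :=
  (lebesgue_outer_measure : set (caratheodory_type lebesgue_outer_measure) -> _).

End lebesgue_measure_rV.

Section sobolev.
Variables (R : realType) (n : nat).
Implicit Types (D : set 'rV[R]_n) (u g phi : 'rV[R]_n -> R).

Definition partial_derive (i : 'I_n) phi : 'rV[R]_n -> R :=
  fun x => 'D_(delta_mx ord0 i) phi x.

Fixpoint Ck (k : nat) phi : Prop :=
  continuous phi /\
  if k is k'.+1 then
    forall i : 'I_n, (forall x, derivable phi x (delta_mx ord0 i)) /\
                     Ck k' (partial_derive i phi)
  else True.

Definition test_function D phi :=
  [/\ forall k, Ck k phi, compact (closure [set x | phi x != 0]) &
      closure [set x | phi x != 0] `<=` D].

Definition in_Lp (p : \bar R) D u :=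
  (u \_ D : lebesgue_type R n -> R) \in Lfun (@lebesgue_rV R n) p.

Definition weak_partial D (i : 'I_n) u g :=
  forall phi, test_function D phi ->
  \int[@lebesgue_rV R n]_(x in D) (u x * partial_derive i phi x) =
  - \int[@lebesgue_rV R n]_(x in D) (g x * phi x).

Definition sobolev1 (p : \bar R) D u :=
  in_Lp p D u /\ forall i, exists g, in_Lp p D g /\ weak_partial D i u g.

End sobolev.

(* Main.v *)
From HB Require Import structures.
Require Import Defs.
From mathcomp Require Import all_boot all_order all_algebra.
From mathcomp Require finmap.
From mathcomp Require Import all_classical all_reals all_analysis.
From mathcomp Require Import measurable_realfun lra.

Set Implicit Arguments.
Unset Strict Implicit.
Unset Printing Implicit Defensive.

Import Order.TTheory GRing.Theory Num.Theory.
Import numFieldNormedType.Exports.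

Local Open Scope classical_set_scope.
Local Open Scope ring_scope.

(* A minimizing sequence of feasible pairs has a weak-* convergent subsequence,
   by compactness of the sets of probability measures on O1 x O2 and on O1; the
   point is that optimality of the plans survives in the limit.  For this, every
   competitor phi in Pi(mu, mu2) of the limit plan is approximated by plans
   phi_k in Pi(mu_k, mu2) whose costs are asymptotically at most that of phi.
   Both facts come from an explicit Skorokhod representation.  Points of a
   compact set are coded by infinite binary words, a probability measure P
   induces a weight w on finite words, and t in [0, 1[ is sent to the point
   X t whose code is the branch followed by t in the partition of [0, 1[ into
   consecutive intervals of lengths w(s); the law of X is P.  Weights converging
   along a subsequence give compactness.  When phi and mu_k are coded so that
   the first N bits only depend on the O1 coordinate, through small balls whose
   boundaries are null for mu, the variables X and Y_k with laws phi and mu_k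
   satisfy |Y_k - P_1 X| < r eventually almost everywhere, and phi_k is the law
   of (Y_k, P_2 X). *)

(** * Functions and probability measures on R^n *)

(** A competitor for the limit plan has first marginal mu, so it is not admissible in the k-th
    lower-level problem, whose first marginal is mu_k. Moving mass in the first coordinate only
    repairs this: the second marginal stays exactly the same, and where the move is shorter than a
    modulus r of uniform continuity of the cost, its price is at most e/2. The move is short
    wherever the two trees send t down the same first N turns, since these N bits name balls of a
    cover of O1. The turns agree for large k unless t is one of the countably many split points of
    the limit tree, provided that the weights of the words of length at most N converge. Weak
    convergence yields the limit of the mass of a set only when its boundary is null for the limit,
    whence the condition on the balls. Beyond the first N bits nothing is compared, so any code that
    separates points is good enough there. *)

Section borel_rV.
Variables (R : realType) (n : nat).
Implicit Types (A U F : set 'rV[R]_n) (x y : 'rV[R]_n).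

Lemma open_measurable_rV U : open U -> measurable U.
Proof. exact: sub_sigma_algebra. Qed.

Lemma closed_measurable_rV F : closed F -> measurable F.
Proof.
move=> cF; rewrite -(setCK F); apply: measurableC.
by apply: open_measurable_rV; exact: closed_openC.
Qed.

Lemma compact_measurable_rV F : compact F -> measurable F.
Proof.
by move=> /(compact_closed (@norm_hausdorff R 'rV[R]_n)); exact: closed_measurable_rV.
Qed.

Lemma measurable_fun_rV d (T : measurableType d) (g : T -> 'rV[R]_n) :
  (forall U, open U -> measurable (g @^-1` U)) -> measurable_fun setT g.
Proof.
move=> mg; apply: (@measurability _ _ _ _ setT g (@open 'rV[R]_n)) => //.
by move=> _ [U oU <-]; rewrite setTI; exact: mg.
Qed.

Lemma continuous_measurable_fun_rV (f : 'rV[R]_n -> R) :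
  continuous f -> measurable_fun setT f.
Proof.
move=> /continuousP cf; apply: (measurability _ (RGenOpens.measurableE R)).
move=> _ [_ [a [b ->] <-]]; rewrite setTI; apply: open_measurable_rV.
exact/cf/interval_open.
Qed.

(* Capping by 1 keeps the infimum meaningful when [A] is empty. *)
Definition setdist A x : R := inf (1 |` [set `|x - y| | y in A]).

Let setdist_lb A x : lbound (1 |` [set `|x - y| | y in A]) 0.
Proof. by move=> _ [->|[y _ <-]]. Qed.

Lemma setdist_ge0 A x : 0 <= setdist A x.
Proof. by apply: lb_le_inf; [exists 1; left|exact: setdist_lb]. Qed.

Lemma setdist_le1 A x : setdist A x <= 1.
Proof. by apply: ge_inf; [exists 0; exact: setdist_lb|left]. Qed.

Lemma setdist_eq0 A x : A x -> setdist A x = 0.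
Proof.
move=> Ax; apply/eqP; rewrite eq_le setdist_ge0 andbT.
apply: ge_inf; first by exists 0; exact: setdist_lb.
by right; exists x => //; rewrite subrr normr0.
Qed.

Lemma setdist_gt0 A x : closed A -> ~ A x -> 0 < setdist A x.
Proof.
move=> cA nAx; have : nbhs x (~` A).
  by apply: open_nbhs_nbhs; split => //; exact: closed_openC.
move=> /nbhs_normP[e /= e0 xeA].
apply: (@lt_le_trans _ _ (Num.min 1 e)); first by rewrite lt_min ltr01.
apply: lb_le_inf; first by exists 1; left.
move=> _ [->|[y Ay <-]]; first by rewrite ge_min lexx.
rewrite ge_min; apply/orP; right; apply: contrapT => /negP; rewrite -ltNge.
by move=> xye; exact: (xeA y).
Qed.

Lemma setdist_lipschitz A x y : `|setdist A x - setdist A y| <= `|x - y|.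
Proof.
wlog: x y / setdist A y <= setdist A x => [wlg|yx].
  have [/wlg//|/ltW/wlg] := leP (setdist A y) (setdist A x).
  by rewrite distrC (distrC x).
rewrite ger0_norm ?subr_ge0// lerBlDr -lerBlDl.
apply: lb_le_inf; first by exists 1; left.
move=> _ [->|[z Az <-]].
  by rewrite lerBlDl (le_trans (setdist_le1 _ _))// lerDr.
rewrite lerBlDl.
apply: (@le_trans _ _ `|x - z|); last exact: ler_distD.
by apply: ge_inf; [exists 0; exact: setdist_lb|right; exists z].
Qed.

Lemma nbhs_ball_rV x (r : R) : 0 < r -> nbhs x (ball_ Num.Def.normr x r).
Proof. by move=> r0; rewrite ball_normE; exact: nbhsx_ballx. Qed.

Lemma lipschitz_continuous (f : 'rV[R]_n -> R) :
  (forall x y, `|f x - f y| <= `|x - y|) -> continuous f.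
Proof.
move=> fl x; apply: (proj2 (@cvgrPdist_le _ _ _ (nbhs x) (nbhs_filter x) _ _)).
move=> e e0; suff : nbhs_ball_ (ball_ Num.Def.normr) x [set y | `|f x - f y| <= e].
  by move=> /nbhs_normP.
by exists e => //= y /ltW xye; exact: le_trans (fl _ _) xye.
Qed.

Lemma dist_continuous y : continuous (fun x => `|y - x|).
Proof.
apply: lipschitz_continuous => x z; apply: le_trans (ler_dist_dist _ _) _.
by rewrite opprB addrC subrKA distrC.
Qed.

Lemma setdist_continuous A : continuous (setdist A).
Proof. by apply: lipschitz_continuous => x y; exact: setdist_lipschitz. Qed.

End borel_rV.

Lemma bounded_cvg_Rintegral d (T : measurableType d) (R : realType)
    (P : probability T R) (f_ : nat -> T -> R) (f : T -> R) (M : R) :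
  (forall k, measurable_fun setT (f_ k)) -> measurable_fun setT f ->
  {ae P, forall x, f_ k x @[k --> \oo] --> f x} ->
  (forall k x, `|f_ k x| <= M) ->
  \int[P]_x f_ k x @[k --> \oo] --> \int[P]_x f x.
Proof.
move=> mf_ mf cf fM.
have [] := @dominated_convergence _ _ _ P setT measurableT
   (fun k x => (f_ k x)%:E) (EFin \o f) (EFin \o cst M).
- by move=> k; apply/measurable_EFinP; exact: mf_.
- exact/measurable_EFinP.
- apply: filterS cf => x fx _; apply: cvg_EFin => //; exact: nearW.
- exact: (@finite_measure_integrable_cst _ _ _ P setT M measurableT).
- by apply: aeW => x k _; rewrite lee_fin.
move=> intf _ cint; apply: fine_cvg.
by rewrite -[X in _ --> X]fineK in cint; [|exact: integrable_fin_num].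
Qed.

Lemma exists_mfun d d' (aT : measurableType d) (rT : measurableType d')
    (f : aT -> rT) : measurable_fun setT f ->
  exists g : {mfun aT >-> rT}, g = f :> (aT -> rT).
Proof.
move=> mf; pose mixin := isMeasurableFun.Build _ _ _ _ f mf.
by pose g : {mfun aT >-> rT} := HB.pack f mixin; exists g.
Qed.

(** * Bounded continuous test functions *)

Section bcont.
Variable R : realType.

(** Test functions live on the whole space, so that integrals and compositions with projections
    carry no domain; [bcont_extension] is the way back to functions continuous on a compact set. *)
Definition bcont n (f : 'rV[R]_n -> R) :=
  continuous f /\ exists M, forall x, `|f x| <= M.

Lemma bcont_comp m n f (g : 'rV[R]_m -> 'rV[R]_n) : bcont f -> continuous g ->
  bcont (f \o g).
Proof.
move=> [cf [M fM]] cg; split; last by exists M => x; exact: fM.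
by move=> x; apply: continuous_comp; [exact: cg|exact: cf].
Qed.

Variable n : nat.
Implicit Types (f g : 'rV[R]_n -> R).

Lemma bcont_cst (a : R) : bcont (cst a : 'rV[R]_n -> R).
Proof. by split; [exact: cst_continuous|exists `|a|]. Qed.

Lemma bcontD f g : bcont f -> bcont g -> bcont (fun x => f x + g x).
Proof.
move=> [cf [M fM]] [cg [N gN]]; split.
  by move=> x; apply: (@cvgD R R^o _ (nbhs x) (nbhs_filter x) f g); [exact: cf|exact: cg].
by exists (M + N) => x; rewrite (le_trans (ler_normD _ _))// lerD.
Qed.

Lemma bcontB f g : bcont f -> bcont g -> bcont (fun x => f x - g x).
Proof.
move=> [cf [M fM]] [cg [N gN]]; split.
  by move=> x; apply: (@cvgB R R^o _ (nbhs x) (nbhs_filter x) f g); [exact: cf|exact: cg].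
by exists (M + N) => x; rewrite (le_trans (ler_normB _ _))// lerD.
Qed.

Lemma bcont_min f g : bcont f -> bcont g -> bcont (fun x => Num.min (f x) (g x)).
Proof.
move=> [cf [M fM]] [cg [N gN]]; split.
  by move=> x; apply: (@continuous_min _ _ f g x); [exact: cf|exact: cg].
exists (Num.max M N) => x; rewrite le_max.
by case: (leP (f x) (g x)) => _; rewrite ?fM ?gN ?orbT.
Qed.

Lemma bcont_integrable d (T : measurableType d) (P : probability T R)
    (X : T -> 'rV[R]_n) f : measurable_fun setT X -> bcont f ->
  P.-integrable setT (EFin \o (f \o X)).
Proof.
move=> mX [cf [M fM]]; apply: measurable_bounded_integrable => //.
- by rewrite -ge0_fin_numE// fin_num_measure.
- by apply: measurableT_comp => //; exact: continuous_measurable_fun_rV.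
- exists M; split; first exact: num_real.
  by move=> r Mr x _ /=; rewrite (le_trans (fM _))// ltW.
Qed.

(** Tietze extension. The bound [|M| + 1] is positive, as the extension theorem requires, and
    exceeds [M], as [compact_bounded] requires. *)
Lemma bcont_extension (K : set 'rV[R]_n) f : compact K ->
  {within K, continuous f} -> exists2 g, bcont g & {in K, f =1 g}.
Proof.
move=> cK cf.
have : compact (f @` K) by exact: continuous_compact.
move=> /compact_bounded[M [_ fM]].
have [|||g [fg cg gM]] := @continuous_bounded_extension 'rV[R]_n R
    (@pseudometric_normal R _) K _ f (`|M| + 1) _ cf.
- exact: (compact_closed (@norm_hausdorff R 'rV[R]_n)).
- by rewrite ltr_wpDl.
- move=> x Kx; apply: (fM (`|M| + 1)); last by exists x.
  by rewrite (le_lt_trans (ler_norm _))// ltrDl.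
by exists g => //; split => //; exists (`|M| + 1).
Qed.

Lemma Rintegral_distribution d (T : measurableType d) (P : probability T R)
    (X : {mfun T >-> 'rV[R]_n}) f : bcont f ->
  \int[distribution P X]_x f x = \int[P]_t f (X t).
Proof.
move=> bf; congr fine; rewrite integral_distribution//=.
  by apply/measurable_EFinP; apply: continuous_measurable_fun_rV; case: bf.
exact: bcont_integrable.
Qed.

Lemma Rintegral_carried (P : probability 'rV[R]_n R) (K : set 'rV[R]_n) f g :
  measurable K -> P (~` K) = 0%E -> bcont g -> {in K, f =1 g} ->
  \int[P]_(x in K) f x = \int[P]_x g x.
Proof.
move=> mK PK bg fg; rewrite (eq_Rintegral P fg) /Rintegral; congr fine.
rewrite [RHS](negligible_integral (measurableC mK)) ?setTD ?setCK//.
by apply: (@bcont_integrable _ _ P id) => //; exact: measurable_id.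
Qed.

End bcont.

(** * Uniqueness and regularity of probability measures on R^n *)

Section uniqueness.
Variables (R : realType) (n : nat).
Implicit Types (P Q : probability 'rV[R]_n R) (U : set 'rV[R]_n).

(** Continuous functions that increase with [k] to the indicator of an open [U]. *)
Definition open_approx U (k : nat) (x : 'rV[R]_n) : R :=
  Num.min 1 (k%:R * setdist (~` U) x).

Lemma open_approx_ge0 U k x : 0 <= open_approx U k x.
Proof. by rewrite le_min ler01/= mulr_ge0// setdist_ge0. Qed.

Lemma open_approx_norm U k x : `|open_approx U k x| <= 1.
Proof. by rewrite ger0_norm ?open_approx_ge0// ge_min lexx. Qed.

Lemma open_approx_continuous U k : continuous (open_approx U k).
Proof.
move=> x.
apply: (@continuous_min _ _ (cst 1) (fun x => k%:R * setdist (~` U) x) x).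
  exact: cst_continuous.
apply: (@cvgM R 'rV[R]_n (nbhs x) (nbhs_filter x) (cst k%:R) (setdist (~` U))).
  exact: cvg_cst.
exact: setdist_continuous.
Qed.

Lemma open_approx_bcont U k : bcont (open_approx U k).
Proof.
split; first exact: open_approx_continuous.
by exists 1; exact: open_approx_norm.
Qed.

Lemma open_approx_out U k x : ~ U x -> open_approx U k x = 0.
Proof. by move=> Ux; rewrite /open_approx setdist_eq0// mulr0 min_r. Qed.

Lemma open_approx_near U x : open U -> U x ->
  \forall k \near \oo, open_approx U k x = 1.
Proof.
move=> oU Ux; near=> k.
have d0 : 0 < setdist (~` U) x.
  by apply: setdist_gt0; [exact: open_closedC|move=> /(_ Ux)].
apply/min_idPl; rewrite -ler_pdivrMr// div1r.
by near: k; exact: nbhs_infty_ger.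
Unshelve. all: by end_near. Qed.

Lemma open_approx_cvg U x : open U ->
  open_approx U k x @[k --> \oo] --> (\1_U x : R).
Proof.
move=> oU; rewrite indicE; have [|] := boolP (x \in U); rewrite ?inE ?notin_setE => Ux.
  apply: cvg_near_cst; exact: open_approx_near.
by apply: cvg_near_cst; apply: nearW => k; exact: open_approx_out.
Qed.

Lemma cvg_Rintegral_open_approx P U : open U ->
  \int[P]_x open_approx U k x @[k --> \oo] --> fine (P U).
Proof.
move=> oU; have mU := open_measurable_rV oU.
have -> : fine (P U) = \int[P]_x \1_U x.
  by rewrite /Rintegral integral_indic// setIT.
apply: bounded_cvg_Rintegral; first 1 last.
- exact: measurable_indic.
- by apply: aeW => x; exact: open_approx_cvg.
- by move=> k x; exact: open_approx_norm.
- by move=> k; apply: continuous_measurable_fun_rV; exact: open_approx_continuous.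
Qed.

(** The open sets are stable under intersection and generate the Borel sets, and the mass of an open
    set is the limit of the integrals of its [open_approx]. *)
Lemma probability_rV_unique P Q :
  (forall f, bcont f -> \int[P]_x f x = \int[Q]_x f x) ->
  forall A, measurable A -> P A = Q A.
Proof.
move=> PQ; apply: (measure_unique (@open 'rV[R]_n) (fun=> setT)) => //.
- by move=> A B; exact: openI.
- by move=> _; exact: openT.
- by rewrite bigcup_const//; exists 0%N.
- move=> U oU; have mU := open_measurable_rV oU.
  rewrite -[LHS]fineK ?fin_num_measure// -[RHS]fineK ?fin_num_measure//.
  have cP := cvg_Rintegral_open_approx (P := P) oU.
  have cQ := cvg_Rintegral_open_approx (P := Q) oU.
  congr EFin; apply: cvg_unique cQ => //.
  apply: cvg_trans cP; apply: near_eq_cvg; apply: nearW => k.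
  by apply: PQ; exact: open_approx_bcont.
- by move=> k; rewrite -ge0_fin_numE// fin_num_measure.
Qed.

(** [F k] is the set where the [k]-th approximation of the indicator has already reached 1. *)
Lemma open_fsigma U : open U -> exists F : nat -> set 'rV[R]_n,
  [/\ forall k, closed (F k), {homo F : i j / (i <= j)%N >-> i `<=` j} &
      U = \bigcup_k F k].
Proof.
move=> oU; exists (fun k => [set x | 1 <= open_approx U k x]); split.
- move=> k; apply: (@closed_comp _ _ (open_approx U k) [set y | 1 <= y]).
    by move=> x _; exact: open_approx_continuous.
  exact: closed_ge.
- move=> i j ij x /=; rewrite !le_min !lexx/= => /le_trans; apply.
  by rewrite ler_wpM2r ?setdist_ge0// ler_nat.
- apply/seteqP; split => x.
    move=> Ux; have [k _ /(_ k (leqnn k)) /= Uk] := open_approx_near oU Ux.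
    by exists k => //=; rewrite Uk.
  move=> [k _ /=]; apply: contraPP => /(open_approx_out k) ->.
  by apply/negP; rewrite -ltNge.
Qed.

(** Inner sets are closed rather than compact, which makes the class stable under complement: inner
    and outer sets trade places. *)
Definition regular_set P A := forall e : R, 0 < e ->
  exists F U : set 'rV[R]_n, [/\ closed F, open U, F `<=` A, A `<=` U &
    (P (U `\` F) < e%:E)%E].

Lemma cvg_measure_lt (P : probability 'rV[R]_n R) (G : nat -> set 'rV[R]_n) (e : R) :
  (forall k, measurable (G k)) -> {homo G : i j / (i <= j)%N >-> j `<=` i} ->
  (P (\bigcap_k G k) < e%:E)%E -> exists k, (P (G k) < e%:E)%E.
Proof.
move=> mG dG Pe.
have mI : measurable (\bigcap_k G k) by exact: bigcapT_measurable.
have cG : P \o G @ \oo --> P (\bigcap_k G k).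
  apply: nonincreasing_cvg_mu => //.
  - by rewrite -ge0_fin_numE// fin_num_measure.
  - by move=> i j ij; apply/subsetPset; exact: dG.
have := @cvgr_lt R nat \oo _ (fine \o (P \o G)) (fine (P (\bigcap_k G k))) _ e.
case.
- by apply: fine_cvg; rewrite fineK// fin_num_measure.
- by rewrite -lte_fin fineK// fin_num_measure.
move=> k _ /(_ k (leqnn k)) /= Gk; exists k.
by rewrite -[P _]fineK ?lte_fin// fin_num_measure.
Qed.

(** The regular sets form a sigma-algebra, and it contains the open sets by [open_fsigma] and
    continuity from above. *)
Lemma probability_rV_regular P A : measurable A -> regular_set P A.
Proof.
suff sreg : sigma_algebra setT (regular_set P).
  apply: (smallest_sub sreg) => U oU e e0.
  have [F [cF ndF UF]] := open_fsigma oU.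
  have [|||k Pk] := @cvg_measure_lt P (fun k => U `\` F k) e.
  - move=> k; apply: measurableD; first exact: open_measurable_rV.
    exact: closed_measurable_rV.
  - by move=> i j ij; apply: setDS; exact: ndF.
  - rewrite (_ : \bigcap_k _ = set0) ?measure0 ?lte_fin//.
    rewrite -subset0 => x /= Ix; have [Ux _] := Ix 0%N Logic.I.
    by move: (Ux); rewrite UF => -[k _ Fk]; have [] := Ix k Logic.I.
  exists (F k), U; split => //.
  by rewrite UF => x Fx; exists k.
split.
- move=> e e0; exists set0, set0; split; [exact: closed0|exact: open0|by []|by []|].
  by rewrite set0D measure0 lte_fin.
- move=> B rB e e0; have [F [U [cF oU FB BU PUF]]] := rB e e0.
  exists (~` U), (~` F); split.
  + exact: open_closedC.
  + exact: closed_openC.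
  + by rewrite setTD; exact: subsetC.
  + by rewrite setTD; exact: subsetC.
  + by rewrite setDE setCK setIC -setDE.
- move=> B rB e e0.
  (* The errors sum to at most [e / 2], which leaves a strict gap below [e]. The union of all the
     [F k] need not be closed, so only finitely many are kept; [cvg_measure_lt] says how many. *)
  have e2 k : 0 < (e / 2) / (2 ^ k.+1)%:R by rewrite !divr_gt0// ltr0n expn_gt0.
  have /choice[F /choice[U FU]] k := rB k _ (e2 k).
  pose V := \bigcup_k U k.
  have oV : open V by apply: bigcup_open => k _; have [] := FU k.
  have cF m : closed (\bigcup_(k < m) F k).
    apply: closed_bigcup; first exact: finite_II.
    by move=> k _; have [] := FU k.
  have [|||k Pk] := @cvg_measure_lt P (fun m => V `\` \bigcup_(k < m) F k) e.
  + move=> m; apply: measurableD; first exact: open_measurable_rV.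
    exact: closed_measurable_rV.
  + move=> i j ij; apply: setDS; apply: bigcup_subset => k /= ki.
    exact: leq_trans ki ij.
  + have mUF k : measurable (U k `\` F k).
      have [cFk oUk _ _ _] := FU k; apply: measurableD.
        exact: open_measurable_rV.
      exact: closed_measurable_rV.
    apply: (@le_lt_trans _ _ (e / 2)%:E); last first.
      by rewrite lte_fin ltr_pdivrMr// ltr_pMr// ltr1n.
    apply: (@le_trans _ _ (\sum_(0 <= k <oo) P (U k `\` F k))%E).
      apply: measure_sigma_subadditive => //.
        apply: bigcapT_measurable => m; apply: measurableD.
          exact: open_measurable_rV.
        exact: closed_measurable_rV.
      move=> x /= Ix; have [[k _ Uk] _] := Ix 0%N Logic.I.
      exists k => //; split => // Fk; have [_] := Ix k.+1 Logic.I; apply.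
      by exists k => //=.
    have e20 : 0 <= e / 2 by rewrite ltW// divr_gt0.
    have := @epsilon_trick R (fun=> 0%E) (e / 2) xpredT (fun=> lexx _) e20.
    rewrite [X in (_ <= X + _)%E -> _]eseries0// add0e; apply: le_trans.
    apply: lee_nneseries => // k _; rewrite add0e.
    by have [_ _ _ _ /ltW] := FU k.
  exists (\bigcup_(j < k) F j), V; split => //.
  + by move=> x [j _ Fj]; exists j => //; have [_ _ + _ _] := FU j; apply.
  + by move=> x [j _ Bj]; exists j => //; have [_ _ _ + _] := FU j; apply.
Qed.

End uniqueness.

(** * Nonnegative signed measures as probability measures *)

Lemma mnormalize_id d (T : measurableType d) (R : realType)
    (mu : {measure set T -> \bar R}) (P : probability T R) A :
  mu setT = 1%E -> mnormalize mu P A = mu A.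
Proof. by move=> mu1; rewrite /mnormalize mu1 onee_eq0/= invr1 mule1. Qed.

Section nonneg_signed_measure.
Variables (R : realType) (n : nat).

(** The negative part is, up to sign, the mass on the negative set of the Hahn decomposition, where
    a nonnegative charge can only vanish. *)
Lemma jordan_nonneg (nu : {charge set 'rV[R]_n -> \bar R}) :
  (forall A, measurable A -> (0 <= nu A)%E) ->
  forall A, measurable A ->
    jordan_pos (hahn nu) A = nu A /\ jordan_neg (hahn nu) A = 0%E.
Proof.
move=> nu0 A mA; have [_ [mN negN] _ _] := hahn nu.
have neg0 : jordan_neg (hahn nu) A = 0%E.
  rewrite jordan_negE cjordan_negE /crestr0 mem_set// /crestr.
  apply/eqP; rewrite oppe_eq0; apply/eqP/le_anti/andP; split.
    by apply: negN; [exact: measurableI|exact: subIsetr].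
  by apply: nu0; exact: measurableI.
by split => //; rewrite (jordan_decomp (hahn nu) mA) /cadd/= cscaleN1/= neg0 oppe0 adde0.
Qed.

Lemma total_variation_nonneg (nu : {charge set 'rV[R]_n -> \bar R}) :
  (forall A, measurable A -> (0 <= nu A)%E) ->
  forall A, measurable A -> Defs.total_variation nu A = nu A.
Proof.
move=> nu0 A mA; rewrite /Defs.total_variation /charge_variation/=.
have [Ep En] := jordan_nonneg nu0 mA.
by rewrite -[RHS]adde0; congr (_ + _)%E.
Qed.

(** The analysis is done with probability measures on the whole space; this relation transfers it to
    the signed measures of the statement. *)
Definition represents (X : set 'rV[R]_n) (mu : signed_measure X)
    (P : probability 'rV[R]_n R) := forall A, measurable A -> mu A = P A.

Section represents.
Variables (X : set 'rV[R]_n) (mX : measurable X).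
Implicit Types (mu : signed_measure X) (P : probability 'rV[R]_n R).

Lemma represents_nonneg mu P : represents mu P -> nonneg mu.
Proof. by move=> muP A mA; rewrite muP. Qed.

Lemma represents_carried mu P : represents mu P -> P (~` X) = 0%E.
Proof.
move=> muP; rewrite -muP; last exact: measurableC.
by apply: charge_of_carried; [exact: measurableC|exact: setICl].
Qed.

Lemma represents_tv_norm mu P : represents mu P -> tv_norm mu = 1%E.
Proof.
move=> muP; rewrite /tv_norm total_variation_nonneg//; last first.
  exact: represents_nonneg muP.
rewrite muP// -[LHS]adde0 -(represents_carried muP).
rewrite -measureU ?setUv ?probability_setT//; last by rewrite setICr.
  exact: probability_setT.
exact: measurableC.
Qed.

Lemma integral_on_represents mu P f : represents mu P ->
  integral_on mu f = \int[P]_(x in X) f x.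
Proof.
move=> muP; have mu0 := represents_nonneg muP.
rewrite /integral_on /charge_integral /Rintegral.
rewrite (@eq_measure_integral _ _ _ X P (jordan_pos (hahn mu))); last first.
  by move=> A mA _; apply: etrans (muP _ mA); have [] := jordan_nonneg mu0 mA.
rewrite (@eq_measure_integral _ _ _ X mzero (jordan_neg (hahn mu))); last first.
  by move=> A mA _; have [] := jordan_nonneg mu0 mA.
by rewrite integral_measure_zero subr0.
Qed.

Lemma integral_on_bcont mu P f g : represents mu P -> bcont g ->
  {in X, f =1 g} -> integral_on mu f = \int[P]_x g x.
Proof.
move=> muP bg fg; rewrite (integral_on_represents _ muP).
by apply: Rintegral_carried => //; exact: represents_carried muP.
Qed.

Lemma nonneg_represents mu : nonneg mu -> mu setT = 1%E ->
  exists P, represents mu P.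
Proof.
move=> mu0 mu1.
(* [dirac 0] is only the default of [mnormalize] for a null or infinite total mass, which
   [mu setT = 1] excludes. *)
exists (mnormalize (jordan_pos (hahn mu)) (dirac (0 : 'rV[R]_n))) => A mA.
have [ET _] := jordan_nonneg mu0 measurableT.
have [EA _] := jordan_nonneg mu0 mA.
rewrite -EA; apply/esym; apply: mnormalize_id.
by rewrite -mu1.
Qed.

Lemma tv_norm_represents mu : nonneg mu -> tv_norm mu = 1%E ->
  exists P, represents mu P.
Proof.
move=> mu0 mu1; apply: nonneg_represents => //.
rewrite /tv_norm total_variation_nonneg// in mu1.
rewrite -(setUv X) chargeU ?setICr//; last exact: measurableC.
rewrite mu1 (charge_of_carried mu (measurableC mX)) ?setICl//; by rewrite adde0.
Qed.

End represents.

(** A signed measure must have compact inner approximations: the closed ones are cut down to [X], at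
    no cost in mass since [P] vanishes off [X]. *)
Lemma represented (X : set 'rV[R]_n) (P : probability 'rV[R]_n R) :
  compact X -> P (~` X) = 0%E -> exists mu : signed_measure X, represents mu P.
Proof.
move=> cX PX; have mX := compact_measurable_rV cX.
pose nu : {charge set 'rV[R]_n -> \bar R} := charge_of_finite_measure P.
have carried A : measurable A -> A `&` X = set0 -> nu A = 0%E.
  move=> mA /disjoints_subset AX; rewrite /nu /= /charge_of_finite_measure.
  exact: (subset_measure0 mA (measurableC mX) AX PX).
have regular : regular_charge nu.
  move=> A mA e e0.
  have [F [U [cF oU FA AU PUF]]] := probability_rV_regular P mA e0.
  have mF := closed_measurable_rV cF; have mU := open_measurable_rV oU.
  exists (F `&` X), U; split => //.
  - by rewrite setIC; apply: compact_closedI.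
  - by move=> x [/FA].
  - rewrite total_variation_nonneg//; last first.
      by apply: measurableD => //; exact: measurableI.
    apply: le_lt_trans PUF; rewrite /nu/= /charge_of_finite_measure setDIr.
    have mUX : measurable (U `\` X) by exact: measurableD.
    apply: le_trans (measureU2 P _ mUX) _; first exact: measurableD.
    rewrite [X in (_ + X)%E](_ : _ = 0%E) ?adde0//.
    apply: subset_measure0 PX => //; exact: measurableC.
by exists (SignedMeasure carried regular).
Qed.

End nonneg_signed_measure.

(** * Binary trees of weights *)

Section words.

Definition bitcode T (h : nat -> T -> bool) m x : seq bool := mkseq (h^~ x) m.

Lemma size_bitcode T (h : nat -> T -> bool) m x : size (bitcode h m x) = m.
Proof. exact: size_mkseq. Qed.

Lemma bitcodeS T (h : nat -> T -> bool) m x :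
  bitcode h m.+1 x = rcons (bitcode h m x) (h m x).
Proof. by rewrite /bitcode /mkseq -addn1 iotaD map_cat cats1. Qed.

Lemma bitcode_eqP T (h : nat -> T -> bool) m x y :
  bitcode h m x = bitcode h m y <-> forall i, (i < m)%N -> h i x = h i y.
Proof.
split=> [xy i im|xy].
  by have := congr1 (nth false ^~ i) xy; rewrite /= !nth_mkseq.
by apply/eq_in_map => i; rewrite mem_iota => /andP[_]; exact: xy.
Qed.

Lemma take_bitcode T (h : nat -> T -> bool) i m x : (i <= m)%N ->
  take i (bitcode h m x) = bitcode h i x.
Proof. by move=> im; rewrite /bitcode /mkseq -map_take take_iota (minn_idPl im). Qed.

Lemma measurable_discrete d (T : measurableType d) (q : T -> seq bool) :
  (forall s, measurable [set t | q t = s]) ->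
  forall S : set (seq bool), measurable [set t | S (q t)].
Proof.
move=> mq S.
rewrite (_ : [set t | S (q t)] =
    \bigcup_k [set t | S (q t) /\ pickle (q t) = k]); last first.
  apply/seteqP; split=> [t St|t [k _ [St _]]//].
  by exists (pickle (q t)).
apply: bigcupT_measurable => k.
have [[t0 [St0 qt0]]|no] := pselect (exists t0, S (q t0) /\ pickle (q t0) = k).
  rewrite (_ : [set t | _] = [set t | q t = q t0]); first exact: mq.
  apply/seteqP; split=> [t [St qt] /=|t /= ->//].
  by apply: (pcan_inj pickleK); rewrite qt qt0.
rewrite (_ : [set t | _] = set0); first exact: measurable0.
by rewrite -subset0 => t tS; apply: no; exists t.
Qed.

Lemma measurable_bitcode d (T : measurableType d) (h : nat -> T -> bool) m :
  (forall i, measurable [set x | h i x]) ->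
  forall s, measurable [set x | bitcode h m x = s].
Proof.
move=> mh; elim: m => [|m IH] s.
  have [->|s0] := eqVneq s [::].
    rewrite (_ : [set x | _] = setT); first exact: measurableT.
    by apply/seteqP; split.
  rewrite (_ : [set x | _] = set0); first exact: measurable0.
  by rewrite -subset0 => x /= xs; move: s0; rewrite -xs eqxx.
case/lastP: s => [|s b].
  rewrite (_ : [set x | _] = set0); first exact: measurable0.
  by rewrite -subset0 => x /= xs; have := size_bitcode h m.+1 x; rewrite xs.
rewrite (_ : [set x | _] = [set x | bitcode h m x = s] `&`
    (if b then [set x | h m x] else ~` [set x | h m x])).
  by apply: measurableI; [exact: IH|case: b => //; exact: measurableC].
apply/seteqP; split=> [x /=|x [/= xs bx]].
  rewrite bitcodeS => /eqP; rewrite eqseq_rcons => /andP[/eqP -> /eqP <-].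
  by case: ifP => //= /negbT/negP.
by rewrite bitcodeS xs; case: b bx => //= [->|/negP/negbTE ->].
Qed.

End words.

Section weighted_tree.
Variable R : realType.

(** The consistency conditions on the cylinder masses of a probability measure on infinite binary
    words. *)
Record tree_weight (w : seq bool -> R) : Prop := TreeWeight {
  tree_weight_ge0 : forall s, 0 <= w s;
  tree_weight_split : forall s, w s = w (rcons s false) + w (rcons s true);
  tree_weight_root : w [::] = 1 }.

Variable w : seq bool -> R.

(** The left endpoint of the interval of [s]: wherever [s] turns right, the weight of the whole
    subtree left behind is counted. *)
Definition tree_left (s : seq bool) : R :=
  \sum_(i < size s | nth false s i) w (rcons (take i s) false).

Lemma tree_left_rcons s b :
  tree_left (rcons s b) = tree_left s + (if b then w (rcons s false) else 0).
Proof.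
rewrite /tree_left size_rcons big_mkcond/= big_ord_recr/= -big_mkcond/=.
congr (_ + _).
  rewrite big_mkcond [RHS]big_mkcond/=; apply: eq_bigr => i _.
  by rewrite nth_rcons ltn_ord -!cats1 takel_cat// ltnW.
by rewrite nth_rcons ltnn eqxx -[rcons s b]cats1 take_size_cat.
Qed.

(** The branch of [t]: it turns right exactly when [t] is not before the split point of the current
    interval. *)
Fixpoint tree_cod (t : R) (m : nat) : seq bool :=
  if m is m'.+1 then
    let s := tree_cod t m' in rcons s (tree_left s + w (rcons s false) <= t)
  else [::].

(** Reads the descent as an instance of [bitcode], whose facts on sizes and prefixes then apply. *)
Lemma tree_codE t m : tree_cod t m =
  bitcode (fun i t => let s := tree_cod t i in
                   tree_left s + w (rcons s false) <= t) m t.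
Proof. by elim: m => //= m IH; rewrite bitcodeS -IH. Qed.

Lemma size_tree_cod t m : size (tree_cod t m) = m.
Proof. by rewrite tree_codE size_bitcode. Qed.

Lemma take_tree_cod t i m : (i <= m)%N -> take i (tree_cod t m) = tree_cod t i.
Proof. by move=> im; rewrite !tree_codE take_bitcode. Qed.

Lemma measurable_tree_cod m s :
  measurable [set t : measurableTypeR R | tree_cod t m = s].
Proof.
elim: m s => [|m IH] s.
  have [->|s0] := eqVneq s [::].
    by rewrite (_ : [set x | _] = setT); [exact: measurableT|exact/seteqP].
  rewrite (_ : [set x | _] = set0); first exact: measurable0.
  by rewrite -subset0 => x /= xs; move: s0; rewrite -xs eqxx.
case/lastP: s => [|s b].
  rewrite (_ : [set x | _] = set0); first exact: measurable0.
  by rewrite -subset0 => x xs; have := size_tree_cod x m.+1; rewrite [tree_cod _ _]xs.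
rewrite (_ : [set x | _] = [set x | tree_cod x m = s] `&`
    (if b then `[tree_left s + w (rcons s false), +oo[%classic
     else `]-oo, tree_left s + w (rcons s false)[%classic)).
  by apply: measurableI; [exact: IH|case: b; exact: measurable_itv].
apply/seteqP; split=> [x /= /eqP|x [/= xs bx]].
  rewrite eqseq_rcons => /andP[/eqP -> /eqP <-]; split => //.
  by case: ifPn => /=; rewrite in_itv/= ?andbT// ltNge.
rewrite xs; congr rcons; case: b bx => /=; rewrite in_itv/= ?andbT//.
by rewrite ltNge => /negbTE.
Qed.

Hypothesis tw : tree_weight w.

Lemma tree_left_ge0 s : 0 <= tree_left s.
Proof. by apply: sumr_ge0 => i _; exact: tree_weight_ge0. Qed.

Lemma tree_left_rcons_ge s b : tree_left s <= tree_left (rcons s b).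
Proof. by rewrite tree_left_rcons lerDl; case: b => //; exact: tree_weight_ge0. Qed.

Lemma tree_right_rcons_le s b :
  tree_left (rcons s b) + w (rcons s b) <= tree_left s + w s.
Proof.
rewrite tree_left_rcons (tree_weight_split tw s) -addrA lerD2l.
by case: b => //; rewrite add0r lerDl tree_weight_ge0.
Qed.

Lemma tree_right_le1 s : tree_left s + w s <= 1.
Proof.
elim/last_ind: s => [|s b IH]; last exact: le_trans (tree_right_rcons_le _ _) IH.
by rewrite /tree_left big_ord0 add0r (tree_weight_root tw).
Qed.

Lemma tree_cod_mem t m : 0 <= t < 1 ->
  tree_left (tree_cod t m) <= t < tree_left (tree_cod t m) + w (tree_cod t m).
Proof.
move=> t01; elim: m => /= [|m /andP[IH1 IH2]].
  by rewrite /tree_left big_ord0 add0r (tree_weight_root tw).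
rewrite tree_left_rcons; set s := tree_cod t m in IH1 IH2 *.
case: (leP (tree_left s + w (rcons s false)) t) => h; last by rewrite addr0 IH1 h.
by rewrite h/= -addrA -tree_weight_split.
Qed.

Lemma tree_cod_eq t s : tree_left s <= t < tree_left s + w s ->
  tree_cod t (size s) = s.
Proof.
elim/last_ind: s => // s b IH /andP[h1 h2].
rewrite size_rcons/= IH; last first.
  by rewrite (le_trans (tree_left_rcons_ge _ b))//= (lt_le_trans h2)// tree_right_rcons_le.
congr rcons; move: h1 h2; rewrite tree_left_rcons; case: b => //.
by rewrite addr0 => _ /lt_geF.
Qed.

(** A parameter outside [0, 1[ also follows some branch, hence the intersection on the left. *)
Lemma tree_cod_preimage s : [set t | tree_cod t (size s) = s] `&` `[0, 1[ =
  `[tree_left s, tree_left s + w s[%classic.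
Proof.
apply/seteqP; split=> [t [/= ts]|t /=]; rewrite !in_itv/=.
  by move=> /(@tree_cod_mem t (size s)); rewrite ts.
move=> st; split; first exact: tree_cod_eq.
case/andP: st => h1 h2; rewrite (le_trans _ h1) ?tree_left_ge0//=.
exact: lt_le_trans h2 (tree_right_le1 _).
Qed.

(** The interval of the current word contains [t], so it is not empty. Branches thus meet only words
    of positive weight, whose cylinders will contain points. *)
Lemma tree_weight_cod_gt0 t m : 0 <= t < 1 -> 0 < w (tree_cod t m).
Proof.
by move=> /(tree_cod_mem m)/andP[h1 h2]; have := le_lt_trans h1 h2; rewrite ltrDl.
Qed.

End weighted_tree.

(** * The uniform law on [0, 1[, as a probability measure on the line *)

Section unit_interval_probability.
Variable R : realType.

Definition unit_prob : set (measurableTypeR R) -> \bar R :=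
  mrestr lebesgue_measure (measurable_itv `[(0 : R), 1[).

HB.instance Definition _ := Measure.on unit_prob.

Let unit_prob_setT : unit_prob setT = 1%E.
Proof.
by rewrite /unit_prob /mrestr setTI lebesgue_measure_itv/= lte01 oppr0 adde0.
Qed.

HB.instance Definition _ :=
  Measure_isProbability.Build _ _ _ unit_prob unit_prob_setT.

Lemma unit_prob_carried : unit_prob (~` `[0, 1[%classic) = 0%E.
Proof. by rewrite /unit_prob /mrestr setICl measure0. Qed.

Lemma unit_prob_tree_cod (w : seq bool -> R) s : tree_weight w ->
  unit_prob [set t | tree_cod w t (size s) = s] = (w s)%:E.
Proof.
move=> tw; rewrite /unit_prob /mrestr tree_cod_preimage//.
rewrite lebesgue_measure_itv/= lte_fin ltrDl.
case: ltP => [_|]; first by rewrite -EFinB addrAC subrr add0r.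
by rewrite le_eqVlt ltNge tree_weight_ge0// orbF => /eqP ->.
Qed.

End unit_interval_probability.
Arguments unit_prob : clear implicits.

(** * Representation of probability measures on [0, 1] *)

Section finite_sums.
Context d (T : measurableType d) (R : realType).
Variable P : probability T R.

Lemma bounded_integrable (F : T -> R) (M : R) : measurable_fun setT F ->
  (forall t, `|F t| <= M) -> P.-integrable setT (EFin \o F).
Proof.
move=> mF FM; apply: measurable_bounded_integrable => //.
  by rewrite -ge0_fin_numE// fin_num_measure.
exists M; split; first exact: num_real.
by move=> r Mr t _ /=; rewrite (le_trans (FM _))// ltW.
Qed.

Lemma Rintegral_sum (I : Type) (r : seq I) (F : I -> T -> R) :
  (forall i, P.-integrable setT (EFin \o F i)) ->
  P.-integrable setT (EFin \o (fun t => \sum_(i <- r) F i t)) /\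
  \int[P]_t (\sum_(i <- r) F i t) = \sum_(i <- r) \int[P]_t F i t.
Proof.
move=> iF; elim: r => [|i r [IHi IH]].
  under eq_fun do rewrite big_nil; rewrite big_nil; split; last first.
    by rewrite Rintegral_cst// mul0r.
  exact: (@finite_measure_integrable_cst _ _ _ P setT 0 measurableT).
under eq_fun do rewrite big_cons; rewrite big_cons; split.
  rewrite (_ : _ \o _ = (EFin \o F i) \+ (EFin \o (fun t => (\sum_(i <- r) F i t)%R)))%E//.
  exact: integrableD.
by rewrite RintegralD// IH.
Qed.

Lemma le_Rintegral_dist (F G : T -> R) (e : R) :
  P.-integrable setT (EFin \o F) -> P.-integrable setT (EFin \o G) ->
  {ae P, forall t, `|F t - G t| <= e} ->
  `|\int[P]_t F t - \int[P]_t G t| <= e.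
Proof.
move=> iF iG FG; rewrite -RintegralB//.
have iFG : P.-integrable setT (EFin \o (fun t => F t - G t)).
  rewrite (_ : _ \o _ = (EFin \o F) \- (EFin \o G))%E//.
  exact: integrableB.
apply: le_trans (le_normr_Rintegral measurableT iFG) _.
have mFG : measurable_fun setT (fun t => F t - G t).
  exact/measurable_EFinP/(measurable_int P).
have -> : e = \int[P]_t e.
  by rewrite Rintegral_cst//= probability_setT mulr1.
rewrite /Rintegral; apply: fine_le.
- apply: integrable_fin_num => //; exact: integrable_norm.
- apply: integrable_fin_num => //.
  exact: (@finite_measure_integrable_cst _ _ _ P setT e measurableT).
- apply: ae_ge0_le_integral => //.
  + by apply/measurable_EFinP; exact: measurableT_comp.
  + move=> t _; rewrite lee_fin.
    (* The sign of [e] is not given: as [P] has mass 1, the almost everywhere bound holds at some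
       point, where [e] dominates an absolute value. *)
    have [//|e0] := leP 0 e.
    have [t1 t1e] : exists t, `|F t - G t| <= e.
      apply: contrapT => no; have : P setT = 0%E.
        case: FG => N [mN N0 sub]; apply: subset_measure0 N0 => //.
        by move=> x _; apply: sub => /= H; apply: no; exists x.
      by rewrite probability_setT => /eqP; rewrite onee_eq0.
    by have := le_lt_trans t1e e0; rewrite normr_lt0.
  + by apply: filterS FG => t FGt _; rewrite lee_fin.
Qed.

Lemma Rintegral_discrete (q : T -> seq bool) m (g : seq bool -> R) :
  (forall s, measurable [set t | q t = s]) -> (forall t, size (q t) = m) ->
  P.-integrable setT (EFin \o (g \o q)) /\
  \int[P]_t g (q t) = \sum_(s : m.-tuple bool) g s * fine (P [set t | q t = s]).
Proof.
move=> mq sq.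
pose F (s : m.-tuple bool) t : R := g s * \1_[set t | q t = s] t.
have iF s : P.-integrable setT (EFin \o F s).
  apply: (@bounded_integrable _ `|g s|).
    by apply: measurable_funM => //; exact: measurable_indic.
  by move=> t; rewrite normrM ler_piMr// indicE; case: (_ \in _); rewrite ?normr1// normr0.
have -> : (g \o q) = fun t => \sum_(s : m.-tuple bool) F s t.
  apply/funext => t /=; have sqt : size (q t) == m by rewrite sq.
  rewrite (bigD1 (Tuple sqt))//= big1 ?addr0 => [|s sn].
    by rewrite /F indicE/= mem_set//= mulr1.
  rewrite /F indicE memNset ?mulr0//= => qts.
  by move/eqP: sn; apply; apply/val_inj.
have [i1 i2] := Rintegral_sum (index_enum _) iF.
split; first exact: i1.
transitivity (\int[P]_t (\sum_(s : m.-tuple bool) F s t)).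
  apply: eq_Rintegral => t _.
  have sqt : size (q t) == m by rewrite sq.
  rewrite (bigD1 (Tuple sqt))//= big1 ?addr0 => [|s sn].
    by rewrite /F indicE/= mem_set//= mulr1.
  rewrite /F indicE memNset ?mulr0//= => qts.
  by move/eqP: sn; apply; apply/val_inj.
rewrite i2; apply: eq_bigr => s _.
rewrite /F RintegralZl//.
  by congr (_ * _); rewrite /Rintegral integral_indic// setIT.
apply: (@bounded_integrable _ 1); first exact: measurable_indic.
by move=> t; rewrite indicE; case: (_ \in _); rewrite ?normr1// normr0.
Qed.

(** The finite sum sees the measure only through the masses of the words of length [m]. With [q] a
    code on R^n or a branch on [0, 1[, it serves as the common term to which integrals on both sides
    are compared. *)
Lemma Rintegral_approx (q : T -> seq bool) m (g : seq bool -> R) (F : T -> R) (e : R) :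
  (forall s, measurable [set t | q t = s]) -> (forall t, size (q t) = m) ->
  P.-integrable setT (EFin \o F) ->
  {ae P, forall t, `|F t - g (q t)| <= e} ->
  `|\int[P]_t F t - \sum_(s : m.-tuple bool) g s * fine (P [set t | q t = s])| <= e.
Proof.
move=> mq sq iF Fg; have [ig <-] := Rintegral_discrete g mq sq.
exact: le_Rintegral_dist.
Qed.

End finite_sums.

(** * Binary codes of the points of a compact set *)

Section resolving.
Variables (R : realType) (n : nat).
Implicit Types (K : set 'rV[R]_n) (h : nat -> 'rV[R]_n -> bool).

Definition resolving h K := forall e : R, 0 < e -> exists N, forall x y,
  K x -> K y -> bitcode h N x = bitcode h N y -> `|x - y| < e.

(** Only one of the two points has to lie in [K]. Otherwise, bad pairs at distance less than 1/(k +
    1) would accumulate at a point of [K], against continuity there. *)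
Lemma compact_uniform K (f : 'rV[R]_n -> R) (e : R) : compact K ->
  continuous f -> 0 < e -> exists2 r : R, 0 < r &
  forall x y, K x -> `|x - y| < r -> `|f x - f y| < e.
Proof.
move=> cK cf e0; apply: contrapT => no.
have bad (k : nat) : exists xy : 'rV[R]_n * 'rV[R]_n,
    [/\ K xy.1, `|xy.1 - xy.2| < k.+1%:R^-1 & e <= `|f xy.1 - f xy.2|].
  apply: contrapT => nok; apply: no; exists k.+1%:R^-1 => // x y Kx xy.
  by rewrite ltNge; apply/negP => fxy; apply: nok; exists (x, y).
have [u uP] := choice bad.
have [p [Kp clp]] : K `&` cluster ((fun k => (u k).1) @ \oo) !=set0.
  by apply: cK; exists 0%N => // k _ /=; have [] := uP k.
have : \forall x \near p, `|f p - f x| < e / 2.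
  have := proj1 (@cvgrPdist_lt _ _ _ (nbhs p) (nbhs_filter p) f (f p)) (cf p).
  by apply; rewrite divr_gt0.
move=> /nbhs_normP[r /= r0 rP].
have r20 : 0 < r / 2 by rewrite divr_gt0.
have [k0 _ k0P] := near_infty_natSinv_lt (PosNum r20).
have [x [[k k0k xE] px]] : [set (u k).1 | k in [set k | (k0 <= k)%N]] `&`
    ball_ Num.Def.normr p (r / 2) !=set0.
  apply: clp; first by exists k0 => // k k0k /=; exists k.
  exact: nbhs_ball_rV.
have [_ xy] := uP k; rewrite leNgt => /negP; apply.
have -> : f (u k).1 - f (u k).2 = (f p - f (u k).2) - (f p - f (u k).1) by lra.
apply: (le_lt_trans (ler_normB _ _)); rewrite (splitr e); apply: ltrD; apply: rP.
- rewrite /ball_/=.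
  have -> : p - (u k).2 = (p - x) + ((u k).1 - (u k).2).
    by rewrite xE addrA subrK.
  apply: (le_lt_trans (ler_normD _ _)); rewrite (splitr r); apply: ltrD => //.
  exact: lt_trans xy (k0P _ k0k).
- rewrite /ball_/= xE; apply: (lt_trans px).
  by rewrite ltr_pdivrMr// ltr_pMr// ltr1n.
Qed.

Lemma resolving_fun h K (f : 'rV[R]_n -> R) (e : R) : compact K ->
  resolving h K -> continuous f -> 0 < e ->
  exists N, forall x y, K x -> K y -> bitcode h N x = bitcode h N y ->
    `|f x - f y| < e.
Proof.
move=> cK rK cf e0; have [r r0 rP] := compact_uniform cK cf e0.
have [N NP] := rK r r0; exists N => x y Kx Ky xy.
by apply: rP => //; exact: NP.
Qed.

Lemma compact_ball_cover K (r : 'rV[R]_n -> R) : compact K ->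
  (forall y, 0 < r y) ->
  exists s : seq 'rV[R]_n, forall x, K x -> exists2 y, y \in s & `|y - x| < r y.
Proof.
move=> cK r0; move: cK; rewrite compact_cover => /(_ _ setT (fun y => ball y (r y))).
case.
- by move=> y _; exact: ball_open.
- by move=> x _; exists x => //; exact: ballxx.
move=> D _ KD; exists (finmap.enum_fset D) => x /KD[y yD].
by rewrite -ball_normE/= => xy; exists y.
Qed.

Lemma measurable_ball_rV (y : 'rV[R]_n) (r : R) :
  measurable [set x | `|y - x| < r].
Proof.
apply: open_measurable_rV; rewrite -[X in open X]/(ball_ _ _ _) ball_normE.
exact: ball_open.
Qed.

(** The bits test membership in the balls of finite covers of [K] with radii 1/(m + 1), the [i]-th
    ball of the [m]-th cover having number [pickle (m, i)]. Two points with the same bits share a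
    ball. *)
Lemma exists_resolving K : compact K -> exists2 h : nat -> 'rV[R]_n -> bool,
  (forall i, measurable [set x | h i x]) & resolving h K.
Proof.
move=> cK.
have [c cP] := choice (fun m => compact_ball_cover cK
  (fun=> ltac:(by rewrite invr_gt0 ltr0Sn) : 0 < m.+1%:R^-1 :> R)).
exists (fun j x => if unpickle j is Some (m, i) then
    (i < size (c m))%N && (`|nth 0 (c m) i - x| < m.+1%:R^-1 :> R) else false).
  move=> j; case: (unpickle j) => [[m i]|].
    case: (i < size (c m))%N => /=; first exact: measurable_ball_rV.
    by rewrite (_ : [set _ | _] = set0)// -subset0.
  by rewrite (_ : [set _ | _] = set0)// -subset0.
move=> e e0; have e20 : 0 < e / 2 by rewrite divr_gt0.
have [m _ /(_ m (leqnn m)) /= mP] := near_infty_natSinv_lt (PosNum e20).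
(* Long enough to contain the bits of all the balls of the [m]-th cover, wherever [pickle] has
   placed them. *)
exists (\max_(i < size (c m)) pickle (m, nat_of_ord i)).+1 => x y Kx Ky.
move=> /bitcode_eqP xy; have [z zc zx] := cP m x Kx.
have iz : (index z (c m) < size (c m))%N by rewrite index_mem.
have := xy (pickle (m, index z (c m))); rewrite ltnS pickleK iz/= nth_index// zx.
move=> /(_ (leq_bigmax (Ordinal iz)))/esym zy.
have -> : x - y = (z - y) - (z - x) by rewrite opprB [RHS]addrC addrA subrK.
apply: (le_lt_trans (ler_normB _ _)); rewrite (splitr e).
by apply: ltrD; [apply: lt_trans mP|apply: lt_trans mP].
Qed.

End resolving.

(** * The random variable attached to a weight *)

Section skorokhod.
Variables (R : realType) (n : nat) (K : set 'rV[R]_n).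
Variable h : nat -> 'rV[R]_n -> bool.

Definition cylinder (s : seq bool) := [set x | K x /\ bitcode h (size s) x = s].

Hypotheses (cK : compact K) (mh : forall i, measurable [set x | h i x]).
Hypothesis rh : resolving h K.

(** Cylinders are not closed in general, and the limit points constructed below lie only in their
    closures. The strict bound on a cylinder survives there as a weak one. *)
Lemma resolving_closure (f : 'rV[R]_n -> R) (e : R) : continuous f -> 0 < e ->
  exists N, forall s, size s = N -> forall x y, closure (cylinder s) x ->
    cylinder s y -> `|f x - f y| <= e.
Proof.
move=> cf e0; have [N NP] := resolving_fun cK rh cf e0.
exists N => s sN x y clx [Ky ys].
have : closed [set z | `|f z - f y| <= e].
  apply: (@closed_comp _ _ (fun z => `|f z - f y|) [set r | r <= e]).
    move=> z _; apply: (@continuous_comp _ _ _ (fun z => f z - f y) (@Num.Def.normr R R)).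
      apply: (@cvgB R R^o 'rV[R]_n (nbhs z) (nbhs_filter z) f (cst (f y))).
        exact: cf.
      exact: cvg_cst.
    exact: norm_continuous.
  exact: closed_le.
move=> /closure_id clE; suff : [set z | `|f z - f y| <= e] x by [].
rewrite clE; apply: closureS clx => z [Kz zs] /=; apply: ltW.
by apply: NP => //; rewrite -sN zs ys.
Qed.

Lemma word_approx (f : 'rV[R]_n -> R) (e : R) : continuous f -> 0 < e ->
  exists N, exists g : seq bool -> R, forall s, size s = N ->
    forall x, closure (cylinder s) x -> `|f x - g s| <= e.
Proof.
move=> cf e0; have [N NP] := resolving_closure cf e0.
(* The value of [f] at a chosen point of the cylinder. The default [0] serves only empty cylinders,
   whose closure is empty too. *)
exists N, (fun s => f (xget 0 (cylinder s))) => s sN x clx.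
apply: (NP s) => //.
have [y sy] : cylinder s !=set0.
  by have [y [sy _]] := clx setT (filterT); exists y.
by case: xgetP => // /(_ y).
Qed.

Lemma Rintegral_word_approx (Q : probability 'rV[R]_n R) (f : 'rV[R]_n -> R)
    (e : R) N (g : seq bool -> R) : Q (~` K) = 0%E -> bcont f ->
  (forall s, size s = N ->
    forall x, closure (cylinder s) x -> `|f x - g s| <= e) ->
  `|\int[Q]_x f x -
    \sum_(s : N.-tuple bool) g s * fine (Q [set x | bitcode h N x = s])| <= e.
Proof.
move=> QK bf fg; apply: Rintegral_approx.
- exact: measurable_bitcode.
- by move=> x; rewrite size_bitcode.
- exact: (@bcont_integrable _ _ _ _ Q id).
- exists (~` K); split => //; first by apply: measurableC; exact: compact_measurable_rV.
  move=> x /= nfx Kx; apply: nfx; apply: fg; first by rewrite size_bitcode.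
  by apply: subset_closure; split => //; rewrite size_bitcode.
Qed.

Variable w : seq bool -> R.
Hypothesis tw : tree_weight w.
Hypothesis wcyl : forall s, 0 < w s -> cylinder s !=set0.

(** One point is chosen in each of the nested cylinders along the branch; the chosen points are
    eventually in every one of these cylinders, so a cluster point is in all the closures. *)
Lemma skorokhod_limit t : 0 <= t < 1 ->
  exists x, forall m, closure (cylinder (tree_cod w t m)) x.
Proof.
move=> t01.
have /choice[u uP] m := wcyl (tree_weight_cod_gt0 tw m t01).
have [p [Kp clp]] : K `&` cluster (u @ \oo) !=set0.
  by apply: cK; exists 0%N => // k _ /=; have [] := uP k.
exists p => m B pB.
have [||y [yc By]] := clp (cylinder (tree_cod w t m)) B => //; last by exists y.
exists m => // k /= mk; have [Kk ck] := uP k; split => //.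
rewrite size_tree_cod -(take_tree_cod w t mk) -ck.
by rewrite size_tree_cod take_bitcode.
Qed.

Theorem skorokhod : exists X : {mfun measurableTypeR R >-> 'rV[R]_n},
  (forall t, K (X t)) /\
  (forall t m, 0 <= t < 1 -> closure (cylinder (tree_cod w t m)) (X t)).
Proof.
have [x0 [Kx0 _]] : cylinder [::] !=set0.
  by apply: wcyl; rewrite (tree_weight_root tw).
have clK s : closure (cylinder s) `<=` K.
  have /closure_id -> := compact_closed (@norm_hausdorff R 'rV[R]_n) cK.
  by apply: closureS => x [].
(* Off [0, 1[, which is null for [unit_prob], any point of [K] will do. *)
pose X (t : R) : 'rV[R]_n :=
  if pselect (0 <= t < 1) is left t01 then sval (cid (skorokhod_limit t01)) else x0.
have XP t m : 0 <= t < 1 -> closure (cylinder (tree_cod w t m)) (X t).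
  move=> t01; rewrite /X; case: pselect => // t01'.
  exact: (svalP (cid (skorokhod_limit t01'))).
have XK t : K (X t).
  have [t01|nt01] := pselect (0 <= t < 1); first exact: clK (XP t 0%N t01).
  by rewrite /X; case: pselect.
have mX : measurable_fun setT (X : measurableTypeR R -> 'rV[R]_n).
  apply: measurable_fun_rV => U oU.
  (* [X] comes from a choice at each [t], yet it is measurable: closed cylinders along a branch
     shrink to the point, so [X t] lies in the open [U] exactly when the closed cylinder of some
     finite word of the branch is contained in [U], and finite words are countably many. *)
  rewrite (_ : X @^-1` U =
     (`[0, 1[%classic `&` \bigcup_m [set t : measurableTypeR R |
         closure (cylinder (tree_cod w t m)) `<=` U]) `|`
     (~` `[0, 1[%classic `&` [set _ | U x0])).
    apply: measurableU; apply: measurableI.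
    - exact: measurable_itv.
    - apply: bigcupT_measurable => m.
      apply: (@measurable_discrete _ _ (fun t => tree_cod w t m) _
        [set s | closure (cylinder s) `<=` U]).
      exact: measurable_tree_cod.
    - by apply: measurableC; exact: measurable_itv.
    - have [Ux0|nUx0] := pselect (U x0).
        by rewrite (_ : [set _ | _] = setT)//; apply/seteqP; split.
      by rewrite (_ : [set _ | _] = set0)// -subset0.
  have E t : `[0, 1[%classic t <-> 0 <= t < 1 by rewrite /= in_itv.
  apply/seteqP; split=> t; last first.
    move=> [[/E t01 [m _]]|[]].
      by apply; exact: XP.
    by move=> nt Ux0; rewrite /= /X; case: pselect => // /E.
  move=> /= UX; have [t01|nt01] := pselect (0 <= t < 1); last first.
    right; split; first by move=> /E.
    by move: UX; rewrite /X; case: pselect.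
  left; split; first exact/E.
  have := oU; rewrite openE => /(_ _ UX) /nbhs_normP[r /= r0 rU].
  have r20 : 0 < r / 2 by rewrite divr_gt0.
  have r20' : 0 < r / 2 / 2 by rewrite divr_gt0.
  (* Used with the distance to [X t]: both [X t] and [z] are in the closure of the cylinder of [y],
     so [y] is within r/4 of [X t], and [z] within r/2. *)
  have [N NP] := resolving_closure (@dist_continuous R n (X t)) r20'.
  have [y yc] := wcyl (tree_weight_cod_gt0 tw N t01).
  exists N => // z zc; apply: rU; rewrite /ball_/=.
  have h1 := NP _ (size_tree_cod w t N) z y zc yc.
  have h2 := NP _ (size_tree_cod w t N) (X t) y (XP t N t01) yc.
  move: h1 h2; rewrite subrr normr0 sub0r normrN normr_id => h1 h2.
  have := le_trans (ler_norm _) h1; lra.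
have [Xm XmE] := exists_mfun mX.
by exists Xm; rewrite XmE.
Qed.

Lemma Rintegral_skorokhod_approx (X : {mfun measurableTypeR R >-> 'rV[R]_n})
    (f : 'rV[R]_n -> R) (e : R) N (g : seq bool -> R) :
  (forall t m, 0 <= t < 1 -> closure (cylinder (tree_cod w t m)) (X t)) ->
  bcont f ->
  (forall s, size s = N ->
    forall x, closure (cylinder s) x -> `|f x - g s| <= e) ->
  `|\int[distribution (unit_prob R) X]_x f x - \sum_(s : N.-tuple bool) g s * w s| <= e.
Proof.
move=> XP bf fg; rewrite Rintegral_distribution//.
rewrite [X in _ - X](_ : _ = \sum_(s : N.-tuple bool) g s *
    fine (unit_prob R [set t | tree_cod w t N = s])); last first.
  apply: eq_bigr => s _; congr (_ * _).
  by have := unit_prob_tree_cod s tw; rewrite size_tuple => ->.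
apply: Rintegral_approx.
- exact: measurable_tree_cod.
- by move=> t; rewrite size_tree_cod.
- by apply: bcont_integrable.
- exists (~` `[0, 1[%classic); split.
  + by apply: measurableC; exact: measurable_itv.
  + exact: unit_prob_carried.
  + move=> t /= nft t01; apply: nft; apply: fg; first by rewrite size_tree_cod.
    by apply: XP; move: t01; rewrite in_itv.
Qed.

End skorokhod.

(** * Weights induced by a probability measure *)

Section cylinder_weight.
Variables (R : realType) (n : nat) (K : set 'rV[R]_n).
Variable h : nat -> 'rV[R]_n -> bool.
Hypotheses (cK : compact K) (mh : forall i, measurable [set x | h i x]).

(** Unlike [cylinder], the set is not cut with [K], so that every [Q] yields a tree weight. *)
Definition cylinder_weight (Q : probability 'rV[R]_n R) (s : seq bool) : R :=
  fine (Q [set x | bitcode h (size s) x = s]).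

Let mcode s : measurable [set x | bitcode h (size s) x = s].
Proof. exact: measurable_bitcode. Qed.

Lemma cylinder_weight_tree Q : tree_weight (cylinder_weight Q).
Proof.
split.
- by move=> s; rewrite fine_ge0.
- move=> s; rewrite /cylinder_weight -fineD ?fin_num_measure//.
  congr fine; rewrite -measureU//.
    congr (Q _); apply/seteqP; split => x /=; rewrite !size_rcons !bitcodeS.
      by move=> ->; case: (h (size s) x); [right|left].
    by case=> /eqP; rewrite eqseq_rcons => /andP[/eqP].
  rewrite -subset0 => x [/=]; rewrite !size_rcons !bitcodeS => /eqP + /eqP.
  by rewrite !eqseq_rcons => /andP[_ /eqP ->] /andP[_].
- rewrite /cylinder_weight (_ : [set x | _] = setT) ?probability_setT//.
  by apply/seteqP; split.
Qed.

Lemma cylinder_weight_le1 Q s : cylinder_weight Q s <= 1.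
Proof.
by rewrite -lee_fin fineK ?fin_num_measure//; exact: probability_le1.
Qed.

Lemma cylinder_weight_gt0 (Q : probability 'rV[R]_n R) s :
  Q (~` K) = 0%E -> 0 < cylinder_weight Q s ->
  cylinder K h s !=set0.
Proof.
move=> QK; apply: contraPP => /set0P/negP/negPn/eqP K0; apply/negP.
rewrite -leNgt /cylinder_weight (_ : Q _ = 0%E)//.
apply: subset_measure0 QK => //; first by apply: measurableC; exact: compact_measurable_rV.
by move=> x xs Kx; have : cylinder K h s x by []; rewrite K0.
Qed.

Hypothesis rh : resolving h K.

(** Under both laws, the integral of a test function is within [e / 2] of the same sum over
    words. *)
Lemma skorokhod_law (Q : probability 'rV[R]_n R)
    (X : {mfun measurableTypeR R >-> 'rV[R]_n}) : Q (~` K) = 0%E ->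
  (forall t m, 0 <= t < 1 ->
    closure (cylinder K h (tree_cod (cylinder_weight Q) t m)) (X t)) ->
  forall A, measurable A -> distribution (unit_prob R) X A = Q A.
Proof.
move=> QK XP; apply: probability_rV_unique => f bf.
apply/eqP; rewrite -subr_eq0 -normr_le0; apply/ler_addgt0Pl => e e0.
rewrite addr0; have e20 : 0 < e / 2 by rewrite divr_gt0.
have [N [g fg]] := word_approx cK rh (proj1 bf) e20.
have h1 := Rintegral_word_approx cK mh QK bf fg.
have h2 := Rintegral_skorokhod_approx (cylinder_weight_tree Q) XP bf fg.
rewrite (splitr e) -[X in `|X|](subrKA
  (\sum_(s : N.-tuple bool) g s * cylinder_weight Q s)).
apply: (le_trans (ler_normD _ _)); apply: lerD => //; rewrite distrC.
rewrite (_ : \sum_(s : N.-tuple bool) _ =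
   \sum_(s : N.-tuple bool) g s * fine (Q [set x | bitcode h N x = s]))//.
by apply: eq_bigr => s _; rewrite /cylinder_weight size_tuple.
Qed.

End cylinder_weight.

(** * Sequential weak compactness *)

Section prokhorov.
Variable R : realType.

(** Tychonoff gives a cluster point [p] in the cube. As [I] is countable, the conditions that the
    coordinates of code below [j] be within 1/(j + 1) of those of [p] are enough to extract a
    subsequence. *)
Lemma unit_cube_subsequence (I : countType) (W : nat -> I -> R) :
  (forall k i, 0 <= W k i <= 1) ->
  exists phi : nat -> nat, exists2 w : I -> R, {homo phi : i j / (i < j)%N} &
    forall i, W (phi k) i @[k --> \oo] --> w i.
Proof.
move=> W01.
have cC : compact [set f : prod_topology (fun _ : I => R) | forall i, `[0, 1]%classic (f i)].
  by apply: (@tychonoff I (fun=> R) (fun=> `[0, 1]%classic)) => i; exact: segment_compact.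
have [p [_ clp]] := cC ((fun k => W k : prod_topology (fun _ : I => R)) @ \oo) _
  (ltac:(by exists 0%N => // k _ i /=; rewrite in_itv/= W01)).
have near_p j : nbhs (p : prod_topology (fun _ : I => R))
    [set f | forall i, (pickle i < j)%N -> `|p i - f i| < j.+1%:R^-1].
  have : nbhs (p : prod_topology (fun _ : I => R))
     [set f | forall a : 'I_j, forall i, pickle i = a -> `|p i - f i| < j.+1%:R^-1].
    pose F (a : 'I_j) (f : prod_topology (fun _ : I => R)) :=
      forall i, pickle i = a -> `|p i - f i| < j.+1%:R^-1.
    suff : nbhs p [set f | forall a : 'I_j, F a f] by [].
    apply: (@filter_forall _ _ F (nbhs p) (nbhs_filter p)) => a.
    case E : (pickle_inv a : option I) => [i|]; last first.
      apply: filterE => f i ia; have := pickleK_inv i; by rewrite ia E.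
    have ball_i : nbhs (p i) [set y : R | `|p i - y| < j.+1%:R^-1].
      by apply/nbhs_normP; exists j.+1%:R^-1 => //=; rewrite invr_gt0.
    have := @proj_continuous I (fun=> R : topologicalType) i p _ ball_i.
    apply: (@filterS _ (nbhs p) (nbhs_filter p)).
    by move=> f fi i' i'a; have := pickleK_inv i'; rewrite i'a E => -[<-].
  apply: (@filterS _ (nbhs p) (nbhs_filter p)) => f fP i ij.
  exact: (fP (Ordinal ij) i erefl).
have step (jm : nat * nat) : exists k, (jm.2 <= k)%N /\
    forall i, (pickle i < jm.1)%N -> `|p i - W k i| < jm.1.+1%:R^-1.
  have [|f [[k mk <-] fP]] := clp [set W k | k in [set k | (jm.2 <= k)%N]] _ _ (near_p jm.1).
    by exists jm.2 => // k mk; exists k.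
  by exists k.
have [g gP] := choice step.
(* [g (j, m)] is an index at least [m] that meets the [j]-th condition; starting after [phi j']
   makes [phi] strictly increasing. *)
pose phi := fix phi j := if j is j'.+1 then g (j, (phi j').+1) else g (0%N, 0%N).
exists phi, p.
  by apply: homo_ltn => [? ? ?|j]; [exact: ltn_trans|have [] := gP (j.+1, (phi j).+1)].
have phiP k i : (pickle i < k)%N -> `|p i - W (phi k) i| < k.+1%:R^-1.
  by case: k => // k ik; have [_ /(_ i ik)] := gP (k.+1, (phi k).+1).
move=> i; apply/cvgrPdist_lt => e e0; near=> k.
apply: (@lt_trans _ _ k.+1%:R^-1); last first.
  by near: k; exact: (near_infty_natSinv_lt (PosNum e0)).
by apply: phiP; near: k; exact: nbhs_infty_gt.
Unshelve. all: by end_near. Qed.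

Variables (n : nat) (K : set 'rV[R]_n).
Hypothesis cK : compact K.

(** The limit weights [w] form a tree weight, and a word with positive limit weight has positive
    weight for some [P_ k], hence a nonempty cylinder: a variable can be built from [w]. Its law
    need not give each cylinder the mass [w s], since it charges closures of cylinders, but
    continuous test functions do not feel the difference in the limit. *)
Theorem probability_subsequence (P_ : nat -> probability 'rV[R]_n R) :
  (forall k, P_ k (~` K) = 0%E) ->
  exists2 phi : nat -> nat, {homo phi : i j / (i < j)%N} &
  exists2 P : probability 'rV[R]_n R, P (~` K) = 0%E &
    forall f, bcont f -> \int[P_ (phi k)]_x f x @[k --> \oo] --> \int[P]_x f x.
Proof.
move=> PK; have [h mh rh] := exists_resolving cK.
have tW k := cylinder_weight_tree mh (P_ k).
have [phi [w homo_phi cw]] := @unit_cube_subsequence _ (fun k => cylinder_weight h (P_ k))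
  (fun k s => introT andP (conj (tree_weight_ge0 (tW k) s) (cylinder_weight_le1 mh (P_ k) s))).
have tw : tree_weight w.
  split.
  - move=> s; rewrite -(cvg_lim (@Rhausdorff R) (cw s)).
    apply: limr_ge; [exact: cvgP (cw s)|apply: nearW => k].
    exact: tree_weight_ge0 (tW _) s.
  - move=> s; apply: (cvg_unique _ (cw s)) => //.
    rewrite (_ : (fun k => _) = fun k => cylinder_weight h (P_ (phi k)) (rcons s false) +
      cylinder_weight h (P_ (phi k)) (rcons s true)); last first.
      by apply/funext => k; exact: tree_weight_split (tW _) s.
    exact: cvgD (cw _) (cw _).
  - apply: (cvg_unique _ (cw [::])) => //.
    rewrite (_ : (fun k => _) = fun=> 1); last first.
      by apply/funext => k; exact: tree_weight_root (tW _).
    exact: cvg_cst.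
have wcyl s : 0 < w s -> cylinder K h s !=set0.
  move=> /(cvgr_gt _ (cw s))[k _ /(_ k (leqnn k))].
  exact: (cylinder_weight_gt0 cK mh (PK (phi k))).
have [X [XK XP]] := skorokhod cK rh tw wcyl.
exists phi => //; exists (distribution (unit_prob R) X).
  transitivity (unit_prob R (X @^-1` (~` K))); first by [].
  rewrite (_ : _ @^-1` _ = set0) ?measure0//.
  by rewrite -subset0 => t /=; apply; exact: XK.
move=> f bf; apply/cvgrPdist_le => e e0.
have e30 : 0 < e / 3 by rewrite divr_gt0.
have [N [g fg]] := word_approx cK rh (proj1 bf) e30.
have h1 := Rintegral_skorokhod_approx tw XP bf fg.
have cS : \sum_(s : N.-tuple bool) g s * cylinder_weight h (P_ (phi k)) s @[k --> \oo]
    --> \sum_(s : N.-tuple bool) g s * w s.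
  by apply: cvg_big => [|s _]; [exact: add_continuous|exact: cvgMl_tmp (cw s)].
near=> k.
have h3 : `|\sum_(s : N.-tuple bool) g s * w s -
    \sum_(s : N.-tuple bool) g s * cylinder_weight h (P_ (phi k)) s| <= e / 3.
  by near: k; exact: cvgr_dist_le cS _ e30.
have := Rintegral_word_approx cK mh (PK (phi k)) bf fg.
rewrite [X in _ - X](_ : _ =
    \sum_(s : N.-tuple bool) g s * cylinder_weight h (P_ (phi k)) s) => [h2|]; last first.
  by apply: eq_bigr => s _; rewrite /cylinder_weight size_tuple.
move: h1 h2 h3; rewrite !ler_norml => /andP[a1 a2] /andP[b1 b2] /andP[c1 c2].
apply/andP; split; lra.
Unshelve. all: by end_near. Qed.

End prokhorov.

(** * Continuity sets *)

Section continuity_sets.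
Variables (R : realType) (n : nat) (P : probability 'rV[R]_n R).
Implicit Types (A B : set 'rV[R]_n).

(* Spheres of distinct radii are disjoint, so only countably many of them can
   have positive measure. *)
Lemma null_level_set (g : 'rV[R]_n -> R) (e : R) : measurable_fun setT g ->
  0 < e -> exists2 r, 0 < r < e & P (g @^-1` [set r]) = 0%E.
Proof.
move=> mg e0; apply: contrapT => no.
have mS r : measurable (g @^-1` [set r]).
  by rewrite -[X in measurable X]setTI; apply: mg => //; exact: measurable_set1.
pose A m := [set r | `]0, e[%classic r /\ (m.+1%:R^-1%:E <= P (g @^-1` [set r]))%E].
have finA m : finite_set (A m).
  apply: contrapT => /infiniteP/pcard_leP/unsquash f.
  have f_inj : injective f.
    by move=> i j fij; apply: (inj (f := f)); rewrite ?inE.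
  have fA i : A m (f i) by apply: funS.
  have [|||k] := @cvg_measure_lt R n P (fun k => \bigcup_(j in [set j | (k <= j)%N])
      (g @^-1` [set f j])) m.+1%:R^-1.
  - by move=> k; apply: bigcup_measurable => j _; exact: mS.
  - move=> i j ij; apply: bigcup_subset => l /=; exact: leq_trans.
  - rewrite (_ : \bigcap_k _ = set0) ?measure0 ?lte_fin ?invr_gt0//.
    rewrite -subset0 => x /= Ix; have [j _ jx] := Ix 0%N Logic.I.
    have [i /= ji ix] := Ix j.+1 Logic.I.
    have : f i = f j by rewrite -[LHS]ix -jx.
    by move/f_inj => ij; move: ji; rewrite ij ltnn.
  rewrite ltNge => /negP; apply.
  have [_ /le_trans] := fA k; apply; apply: le_measure; rewrite ?inE//.
    by apply: bigcup_measurable => j _; exact: mS.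
  by move=> x xk; exists k => //=.
have : countable `]0, e[%classic.
  apply: (@sub_countable _ _ _ (\bigcup_m A m)); last first.
    by apply: bigcup_countable => // m _; exact: finite_set_countable.
  apply: subset_card_le => r r0e.
  have Pr : (0 < P (g @^-1` [set r]))%E.
    rewrite lt0e measure_ge0 andbT; apply/eqP => Pr0; apply: no.
    by exists r => //; move: r0e; rewrite /= in_itv.
  have Pr' : 0 < fine (P (g @^-1` [set r])).
    by rewrite fine_gt0// Pr/= -ge0_fin_numE// fin_num_measure.
  have [m _ /(_ m (leqnn m)) /= mP] := near_infty_natSinv_lt (PosNum Pr').
  exists m => //; split => //.
  by rewrite -[leRHS]fineK ?fin_num_measure// lee_fin ltW.
move=> /countable_lebesgue_measure0; rewrite lebesgue_measure_itv/= lte_fin e0.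
by rewrite oppr0 adde0 => -[] e00; move: e0; rewrite e00 ltxx.
Qed.

(** A sandwich form of having a [P]-null boundary. It is stable under boolean operations and yields
    convergence of masses without mention of boundaries. *)
Definition continuity_set A := measurable A /\ forall e : R, 0 < e ->
  exists f g, [/\ bcont f, bcont g, forall x, f x <= \1_A x <= g x &
    \int[P]_x g x - \int[P]_x f x <= e].

Let bint f : bcont f -> P.-integrable setT (EFin \o f).
Proof. exact: (@bcont_integrable _ _ _ _ P id). Qed.

Lemma continuity_setC A : continuity_set A -> continuity_set (~` A).
Proof.
move=> [mA cA]; split; first exact: measurableC.
move=> e e0; have [f [g [bf bg fg fge]]] := cA e e0.
exists (fun x => 1 - g x), (fun x => 1 - f x).
split; [by apply: bcontB => //; exact: bcont_cst|by apply: bcontB => //; exact: bcont_cst| |].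
  move=> x; have /andP[fx gx] := fg x.
  have -> : \1_(~` A) x = 1 - \1_A x :> R.
    by rewrite !indicE in_setC; case: (_ \in A); rewrite ?subrr ?subr0.
  by rewrite !lerD2l !lerN2 fx gx.
rewrite !RintegralB// ?Rintegral_cst//=; try exact: bint.
- by move: fge; lra.
- exact: (@finite_measure_integrable_cst _ _ _ P setT 1 measurableT).
- exact: (@finite_measure_integrable_cst _ _ _ P setT 1 measurableT).
Qed.

Lemma continuity_setI A B : continuity_set A -> continuity_set B ->
  continuity_set (A `&` B).
Proof.
move=> [mA cA] [mB cB]; split; first exact: measurableI.
move=> e e0; have e20 : 0 < e / 2 by rewrite divr_gt0.
have [f [g [bf bg fg fge]]] := cA _ e20.
have [f' [g' [bf' bg' fg' fge']]] := cB _ e20.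
have bm := bcont_min bf bf'; have bM := bcont_min bg bg'.
exists (fun x => Num.min (f x) (f' x)), (fun x => Num.min (g x) (g' x)).
split => //.
  move=> x; have /andP[h1 h2] := fg x; have /andP[h3 h4] := fg' x.
  have -> : \1_(A `&` B) x = Num.min (\1_A x) (\1_B x) :> R.
    rewrite !indicE in_setI; case: (_ \in A); case: (_ \in B) => /=;
    by case: leP; lra.
  by rewrite !le_min !ge_min h1 h2 h3 h4 !orbT.
rewrite -RintegralB//; try exact: bint.
(* The gap between the two minima is at most the sum of the two gaps, because [f <= g] and
   [f' <= g'] pointwise. *)
apply: (@le_trans _ _ (\int[P]_x ((g x - f x) + (g' x - f' x)))); last first.
  have i1 : P.-integrable setT (EFin \o (fun x => g x - f x)).
    rewrite (_ : _ \o _ = (EFin \o g) \- (EFin \o f))%E//.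
    by apply: integrableB => //; exact: bint.
  have i2 : P.-integrable setT (EFin \o (fun x => g' x - f' x)).
    rewrite (_ : _ \o _ = (EFin \o g') \- (EFin \o f'))%E//.
    by apply: integrableB => //; exact: bint.
  by rewrite RintegralD// !RintegralB//; try exact: bint; lra.
apply: le_Rintegral => //.
- by apply: bint; apply: bcontB.
- by apply: bint; apply: bcontD; apply: bcontB.
- move=> x _; have /andP[h1 h2] := fg x; have /andP[h3 h4] := fg' x.
  by case: (leP (g x) (g' x)); case: (leP (f x) (f' x)); lra.
Qed.

(** The ball is approached from below by [open_approx], and from above by 1 minus the [open_approx]
    of the exterior [B]. As the sphere is null, the masses of ball and exterior add up to 1, so the
    gap closes. *)
Lemma continuity_set_ball y (r : R) : P [set x | `|y - x| = r] = 0%E ->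
  continuity_set [set x | `|y - x| < r].
Proof.
move=> Pr0; have cd := @dist_continuous R n y.
set A := [set x | _]; set B := [set x | r < `|y - x|].
have oA : open A.
  apply: (@open_comp _ _ (fun x : 'rV[R]_n => `|y - x|) [set s | s < r]).
    by move=> x _; exact: cd.
  exact: open_lt.
have oB : open B.
  apply: (@open_comp _ _ (fun x : 'rV[R]_n => `|y - x|) [set s | r < s]).
    by move=> x _; exact: cd.
  exact: open_gt.
have mA := open_measurable_rV oA; have mB := open_measurable_rV oB.
split => // e e0.
have PAB : fine (P A) + fine (P B) = 1.
  rewrite -fineD ?fin_num_measure// -measureU//; last first.
    by rewrite -subset0 => x [/= h1 h2]; have := lt_trans h1 h2; rewrite ltxx.
  rewrite -[RHS]/(fine 1%:E) -(probability_setT P); congr fine.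
  have mS : measurable [set x | `|y - x| = r].
    apply: closed_measurable_rV.
    apply: (@closed_comp _ _ (fun x : 'rV[R]_n => `|y - x|) [set s | s = r]).
      by move=> x _; exact: cd.
    exact: closed_eq.
  rewrite -[LHS]adde0 -Pr0 -measureU//.
  - congr (P _); apply/seteqP; split=> // x _ /=.
    by case: (ltgtP `|y - x| r) => h; [left; left|left; right|right].
  - exact: measurableU.
  - by rewrite -subset0 => x [[/lt_eqF|/gt_eqF] /negbT/eqP].
have cA := cvg_Rintegral_open_approx (P := P) oA.
have cB := cvg_Rintegral_open_approx (P := P) oB.
have cAB : (\int[P]_x open_approx A k x + \int[P]_x open_approx B k x) @[k --> \oo]
    --> fine (P A) + fine (P B) by exact: cvgD cA cB.
have [k _ /(_ k (leqnn k))] : \forall k \near \oo, `|fine (P A) + fine (P B) -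
    (\int[P]_x open_approx A k x + \int[P]_x open_approx B k x)| <= e.
  by exact: cvgr_dist_le cAB _ e0.
rewrite /= PAB => kP; exists (open_approx A k), (fun x => 1 - open_approx B k x).
split.
- exact: open_approx_bcont.
- by apply: bcontB; [exact: bcont_cst|exact: open_approx_bcont].
- move=> x; rewrite indicE; have [xA|xA] := boolP (x \in A).
    rewrite [open_approx B k x]open_approx_out ?subr0 ?lexx ?andbT.
      by have := open_approx_norm A k x; rewrite ger0_norm ?open_approx_ge0.
    move: xA; rewrite inE => h1 h2.
    by have := lt_trans h1 h2; rewrite ltxx.
  rewrite [open_approx A k x]open_approx_out ?lexx/=; last first.
    by move: xA; rewrite notin_setE.
  by rewrite subr_ge0; have := open_approx_norm B k x; rewrite ger0_norm ?open_approx_ge0.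
- rewrite RintegralB// ?Rintegral_cst//=; try exact/bint/open_approx_bcont.
    by move: kP; rewrite probability_setT mulr1 => /(le_trans (ler_norm _)); lra.
  exact: (@finite_measure_integrable_cst _ _ _ P setT 1 measurableT).
Qed.

(** The part of the portmanteau theorem that is used: the sandwich for [P] also encloses the mass of
    [A] under each [P_ k]. *)
Lemma continuity_set_cvg (P_ : nat -> probability 'rV[R]_n R) A :
  (forall f, bcont f -> \int[P_ k]_x f x @[k --> \oo] --> \int[P]_x f x) ->
  continuity_set A -> fine (P_ k A) @[k --> \oo] --> fine (P A).
Proof.
move=> cP [mA cA]; apply/cvgrPdist_le => e e0.
have e20 : 0 < e / 2 by rewrite divr_gt0.
have [f [g [bf bg fg fge]]] := cA _ e20.
have sandwich (Q : probability 'rV[R]_n R) :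
    \int[Q]_x f x <= fine (Q A) <= \int[Q]_x g x.
  have -> : fine (Q A) = \int[Q]_x \1_A x.
    by rewrite /Rintegral integral_indic// setIT.
  have iA : Q.-integrable setT (EFin \o \1_A).
    apply: (@bounded_integrable _ _ _ _ _ 1); first exact: measurable_indic.
    by move=> t; rewrite indicE; case: (_ \in _); rewrite ?normr1// normr0.
  apply/andP; split; apply: le_Rintegral => //.
  - exact: (@bcont_integrable _ _ _ _ Q id).
  - by move=> x _; have /andP[] := fg x.
  - exact: (@bcont_integrable _ _ _ _ Q id).
  - by move=> x _; have /andP[] := fg x.
near=> k.
have h1 : `|\int[P]_x f x - \int[P_ k]_x f x| <= e / 2.
  by near: k; exact: cvgr_dist_le (cP f bf) _ e20.
have h2 : `|\int[P]_x g x - \int[P_ k]_x g x| <= e / 2.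
  by near: k; exact: cvgr_dist_le (cP g bg) _ e20.
move: h1 h2 (sandwich P) (sandwich (P_ k)); rewrite !ler_norml.
move=> /andP[? ?] /andP[? ?] /andP[? ?] /andP[? ?]; apply/andP; split; lra.
Unshelve. all: by end_near. Qed.

Lemma continuity_set_bitcode (h : nat -> 'rV[R]_n -> bool) m :
  (forall i, (i < m)%N -> continuity_set [set x | h i x]) ->
  forall s, continuity_set [set x | bitcode h m x = s].
Proof.
have c0 : continuity_set set0.
  split => // e e0; exists (cst 0), (cst 0).
  split; [exact: bcont_cst|exact: bcont_cst| |by rewrite subrr ltW].
  by move=> x; rewrite indic0/= lexx.
elim: m => [|m IH] ch s.
  have [->|s0] := eqVneq s [::].
    rewrite (_ : [set x | _] = ~` set0); first exact: continuity_setC.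
    by rewrite setC0; apply/seteqP; split.
  rewrite (_ : [set x | _] = set0)//.
  by rewrite -subset0 => x /= xs; move: s0; rewrite -xs eqxx.
case/lastP: s => [|s b].
  rewrite (_ : [set x | _] = set0)//.
  by rewrite -subset0 => x /= xs; have := size_bitcode h m.+1 x; rewrite xs.
have {IH}cs := IH (fun i im => ch i (ltnW im)) s.
rewrite (_ : [set x | _] = [set x | bitcode h m x = s] `&`
    (if b then [set x | h m x] else ~` [set x | h m x])).
  apply: continuity_setI => //; case: b => //; [exact: ch|].
  by apply: continuity_setC; exact: ch.
apply/seteqP; split=> [x /=|x [/= xs bx]].
  rewrite bitcodeS => /eqP; rewrite eqseq_rcons => /andP[/eqP -> /eqP <-].
  by case: ifP => //= /negbT/negP.
by rewrite bitcodeS xs; case: b bx => //= [->|/negP/negbTE ->].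
Qed.

End continuity_sets.

(** * Products *)

Section coordinates.
Variables (R : realType) (n : nat).
Implicit Types (x y : 'rV[R]_n).

Lemma rV_norm_lt x (e : R) : 0 < e -> (forall i, `|x ord0 i| < e) -> `|x| < e.
Proof.
move=> e0 xe; rewrite /Num.Def.normr/= mx_normrE; apply/bigmax_ltP.
by split => //= -[i j] _ /=; rewrite (ord1 i).
Qed.

Lemma rV_coord_le x i : `|x ord0 i| <= `|x|.
Proof.
rewrite [X in _ <= X]/Num.Def.normr/= mx_normrE; apply/bigmax_geP; right => /=.
by exists (ord0, i).
Qed.

(** An open set is a countable union of boxes with rational centre and radius 1/(m + 1), and the
    preimage of a box is a finite intersection of coordinate conditions. *)
Lemma measurable_fun_rV_coord d (T : measurableType d) (Z : T -> 'rV[R]_n) :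
  (forall i, measurable_fun setT (fun t => Z t ord0 i)) ->
  measurable_fun setT Z.
Proof.
move=> mZ; apply: measurable_fun_rV => U oU.
pose box (q : 'rV[rat]_n) m : set 'rV[R]_n :=
  [set x | forall i, `|x ord0 i - ratr (q ord0 i)| < m.+1%:R^-1].
have mbox q m : measurable (Z @^-1` box q m).
  rewrite (_ : _ @^-1` _ = \bigcap_(i in [set: 'I_n])
      ((fun t => Z t ord0 i) @^-1` `]ratr (q ord0 i) - m.+1%:R^-1,
                                    ratr (q ord0 i) + m.+1%:R^-1[%classic)).
    apply: fin_bigcap_measurable => // i _.
    by rewrite -[X in measurable X]setTI; apply: mZ => //; exact: measurable_itv.
  apply/seteqP; split => t /= tq i => [_|].
    by have := tq i; rewrite /= in_itv/= ltr_distl.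
  by have := tq i Logic.I; rewrite /= in_itv/= ltr_distl.
rewrite (_ : Z @^-1` U = \bigcup_k (if unpickle k is Some (q, m) then
    if pselect (box q m `<=` U) then Z @^-1` box q m else set0 else set0)).
  apply: bigcupT_measurable => k.
  case: (unpickle k) => [[q m]|]; last exact: measurable0.
  by case: pselect => _ /=; [exact: mbox|exact: measurable0].
apply/seteqP; split => t /=; last first.
  move=> [k _]; case: (unpickle k) => [[q m]|//].
  by case: pselect => [bU|//] /= tb; exact: bU.
move=> UZ; have := oU; rewrite openE => /(_ _ UZ) /nbhs_normP[r /= r0 rU].
have r20 : 0 < r / 2 by rewrite divr_gt0.
have [m _ /(_ m (leqnn m)) /= mP] := near_infty_natSinv_lt (PosNum r20).
have m0 : 0 < m.+1%:R^-1 :> R by rewrite invr_gt0.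
have qex i : exists q : rat, `|Z t ord0 i - ratr q| < m.+1%:R^-1.
  have [q] := @rat_in_itvoo R (Z t ord0 i - m.+1%:R^-1) (Z t ord0 i + m.+1%:R^-1)
    (ltac:(by rewrite ltrBlDr -addrA ltrDl addr_gt0)).
  by rewrite in_itv/= -ltr_distl distrC => ?; exists q.
have [q qP] := choice qex.
exists (pickle (\row_i q i : 'rV[rat]_n, m)) => //; rewrite pickleK.
have bU : box (\row_i q i) m `<=` U.
  move=> y yq; apply: rU; rewrite /ball_/=; apply: rV_norm_lt => // i.
  have -> : (Z t - y) ord0 i = (Z t ord0 i - ratr (q i)) - (y ord0 i - ratr (q i)).
    by rewrite !mxE opprB addrA subrK.
  rewrite (le_lt_trans (ler_normB _ _))// (splitr r); apply: ltrD.
    exact: lt_trans (qP i) mP.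
  by have := yq i; rewrite mxE => /lt_trans; apply.
by case: pselect => // _ i; rewrite mxE.
Qed.

Lemma measurable_coord i : measurable_fun setT (fun x : 'rV[R]_n => x ord0 i).
Proof.
by apply: continuous_measurable_fun_rV; exact: coord_continuous.
Qed.

End coordinates.

Lemma continuous_measurable_rV (R : realType) m n (g : 'rV[R]_m -> 'rV[R]_n) :
  continuous g -> measurable_fun setT g.
Proof.
move=> /continuousP cg; apply: measurable_fun_rV => U /cg.
exact: open_measurable_rV.
Qed.

(** * The two blocks of a row vector *)

Section row_blocks.
Variables (R : realType) (d1 d2 : nat).

Lemma measurable_lsubmx :
  measurable_fun setT (@lsubmx R 1 d1 d2 : 'rV[R]_(d1 + d2) -> 'rV[R]_d1).
Proof. by apply: continuous_measurable_rV; exact: continuous_lsubmx. Qed.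

Lemma measurable_rsubmx :
  measurable_fun setT (@rsubmx R 1 d1 d2 : 'rV[R]_(d1 + d2) -> 'rV[R]_d2).
Proof. by apply: continuous_measurable_rV; exact: continuous_rsubmx. Qed.

Lemma measurable_row_mx d (T : measurableType d) (Y : T -> 'rV[R]_d1)
    (Z : T -> 'rV[R]_d2) : measurable_fun setT Y -> measurable_fun setT Z ->
  measurable_fun setT (fun t => row_mx (Y t) (Z t) : 'rV[R]_(d1 + d2)).
Proof.
move=> mY mZ; apply: measurable_fun_rV_coord => i.
case: (split_ordP i) => j ->.
  rewrite (_ : (fun t => _) = (fun y : 'rV[R]_d1 => y ord0 j) \o Y).
    by apply: measurableT_comp mY; exact: measurable_coord.
  by apply/funext => t /=; rewrite row_mxEl.
rewrite (_ : (fun t => _) = (fun y : 'rV[R]_d2 => y ord0 j) \o Z).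
  by apply: measurableT_comp mZ; exact: measurable_coord.
by apply/funext => t /=; rewrite row_mxEr.
Qed.

Lemma norm_row_mx_sub (a : 'rV[R]_d1) (z : 'rV[R]_(d1 + d2)) (e : R) : 0 < e ->
  `|a - lsubmx z| < e -> `|z - row_mx a (rsubmx z)| < e.
Proof.
move=> e0 ae; apply: rV_norm_lt => // i; 
have -> : (z - row_mx a (rsubmx z)) ord0 i = z ord0 i - row_mx a (rsubmx z) ord0 i.
  by rewrite [LHS]mxE [X in _ + X]mxE.
case: (split_ordP i) => j ->.
  rewrite row_mxEl distrC; apply: le_lt_trans ae.
  by have := rV_coord_le (a - lsubmx z) j; rewrite !mxE.
by rewrite row_mxEr mxE subrr normr0.
Qed.

Lemma lsubmx_norm_le (x y : 'rV[R]_(d1 + d2)) :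
  `|lsubmx x - lsubmx y| <= `|x - y|.
Proof.
(* By contradiction, because [rV_norm_lt] asks for a positive bound and the right-hand side may be
   0. *)
rewrite leNgt; apply/negP => h.
have : `|lsubmx x - lsubmx y| < `|lsubmx x - lsubmx y|; last by rewrite ltxx.
apply: rV_norm_lt => [|i]; first exact: le_lt_trans h.
apply: le_lt_trans h; have := rV_coord_le (x - y) (lshift d2 i).
by rewrite !mxE.
Qed.

Lemma compact_rv_prod (O1 : set 'rV[R]_d1) (O2 : set 'rV[R]_d2) :
  compact O1 -> compact O2 -> compact (rv_prod O1 O2).
Proof.
move=> c1 c2; apply: bounded_closed_compact.
  have [M1 [_ M1P]] := compact_bounded c1; have [M2 [_ M2P]] := compact_bounded c2.
  exists (Num.max `|M1| `|M2| + 1); split; first exact: num_real.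
  move=> r rM x [/M1P x1 /M2P x2]; apply: ltW; apply: rV_norm_lt.
    by apply: lt_trans rM; rewrite ltr_wpDl// le_max normr_ge0.
  move=> i; apply: le_lt_trans rM; case: (split_ordP i) => j ->.
    apply: (@le_trans _ _ `|lsubmx x|).
      by have := rV_coord_le (lsubmx x) j; rewrite mxE.
    apply: x1; rewrite (le_lt_trans (ler_norm _))//.
    by rewrite ltr_pwDr// le_max lexx.
  apply: (@le_trans _ _ `|rsubmx x|).
    by have := rV_coord_le (rsubmx x) j; rewrite mxE.
  apply: x2; rewrite (le_lt_trans (ler_norm _))//.
  by rewrite ltr_pwDr// le_max lexx orbT.
have hd := compact_closed (@norm_hausdorff R _).
apply: closedI.
  apply: (@closed_comp _ _ (@lsubmx R 1 d1 d2) O1); last exact: hd.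
  by move=> x _; exact: continuous_lsubmx.
apply: (@closed_comp _ _ (@rsubmx R 1 d1 d2) O2); last exact: hd.
by move=> x _; exact: continuous_rsubmx.
Qed.

End row_blocks.

(** * Approximation of competitors *)

Section approximate_competitor.
Variable R : realType.

(** The first [N] tests of a code can therefore be imposed at will. *)
Lemma resolving_prepend n (b : nat -> 'rV[R]_n -> bool) N h (K : set 'rV[R]_n) :
  resolving h K ->
  resolving (fun i x => if (i < N)%N then b i x else h (i - N)%N x) K.
Proof.
move=> rh e e0; have [M MP] := rh e e0; exists (N + M)%N => x y Kx Ky.
move=> /bitcode_eqP xy; apply: MP => //; apply/bitcode_eqP => i iM.
have := xy (N + i)%N; rewrite ltn_add2l => /(_ iM).
by rewrite ltnNge leq_addr/= addKn.
Qed.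

Lemma tree_left_cvg (w_ : nat -> seq bool -> R) (w : seq bool -> R) N s :
  (forall s', (size s' <= N)%N -> w_ k s' @[k --> \oo] --> w s') ->
  (size s <= N)%N -> tree_left (w_ k) s @[k --> \oo] --> tree_left w s.
Proof.
move=> cw sN; rewrite /tree_left.
apply: cvg_big => [|i _]; first exact: add_continuous.
apply: cw; rewrite size_rcons size_take ltn_ord.
exact: leq_trans (ltn_ord i) sN.
Qed.

(** Each bit compares [t] with a split point. The split points converge, so off those of the limit
    every comparison becomes constant, one level after the other. *)
Lemma tree_cod_cvg (w_ : nat -> seq bool -> R) (w : seq bool -> R) N t :
  (forall s', (size s' <= N)%N -> w_ k s' @[k --> \oo] --> w s') ->
  (forall s, t <> tree_left w s + w (rcons s false)) ->
  forall m, (m <= N)%N ->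
  \forall k \near \oo, tree_cod (w_ k) t m = tree_cod w t m.
Proof.
move=> cw tn; elim=> [|m IH] mN; first exact: nearW.
have IHm := IH (ltnW mN).
set s := tree_cod w t m.
have ss : size s = m by rewrite size_tree_cod.
have cL : (tree_left (w_ k) s + w_ k (rcons s false)) @[k --> \oo] -->
    tree_left w s + w (rcons s false).
  apply: cvgD; first by apply: tree_left_cvg cw _; rewrite ss ltnW.
  by apply: cw; rewrite size_rcons ss.
have [tL|Lt] := ltP t (tree_left w s + w (rcons s false)).
  near=> k.
  have Ek : tree_cod (w_ k) t m = s by near: k; exact: IHm.
  have tLk : t < tree_left (w_ k) s + w_ k (rcons s false).
    by near: k; exact: cvgr_gt _ cL _ tL.
  by rewrite /= Ek -/s !leNgt tLk tL.
have {}Lt : tree_left w s + w (rcons s false) < t.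
  by rewrite lt_neqAle Lt andbT; apply/eqP => /esym; exact: tn.
near=> k.
have Ek : tree_cod (w_ k) t m = s by near: k; exact: IHm.
have Lkt : tree_left (w_ k) s + w_ k (rcons s false) < t.
  by near: k; exact: cvgr_lt _ cL _ Lt.
by rewrite /= Ek -/s (ltW Lkt) (ltW Lt).
Unshelve. all: by end_near. Qed.

(** Finite words, and so the split points of the limit tree, are countably many; they form a null
    set. *)
Lemma ae_tree_cod_cvg (w_ : nat -> seq bool -> R) (w : seq bool -> R) N :
  (forall s, (size s <= N)%N -> w_ k s @[k --> \oo] --> w s) ->
  {ae unit_prob R, forall t, 0 <= t < 1 /\
    \forall k \near \oo, tree_cod (w_ k) t N = tree_cod w t N}.
Proof.
move=> cw.
pose A : set (measurableTypeR R) :=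
  range (fun s : seq bool => tree_left w s + w (rcons s false)).
have cA : countable A.
  by apply: sub_countable (card_image_le _ _) _; exact: countableP.
have mA : measurable A.
  by apply: countable_measurable => // t; exact: measurable_set1.
exists (A `|` ~` `[0, 1[%classic); split.
- by apply: measurableU => //; apply: measurableC; exact: measurable_itv.
- apply/eqP; rewrite -measure_le0 -[leRHS]adde0.
  have mC : measurable (~` `[(0 : R), 1[%classic).
    by apply: measurableC; exact: measurable_itv.
  apply: le_trans (measureU2 (unit_prob R) mA mC) _.
  apply: leeD; rewrite le_eqVlt; apply/orP; left; apply/eqP; last first.
    exact: unit_prob_carried.
  transitivity (lebesgue_measure (A `&` `[0, 1[%classic)); first by [].
  apply: countable_lebesgue_measure0; apply: sub_countable cA.
  by apply: subset_card_le => ? [].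
- move=> t /= nt; have [tA|tA] := pselect (A t); first by left.
  have [t01|t01] := pselect (0 <= t < 1); last by right; rewrite /= in_itv.
  exfalso; apply: nt; split => //; apply: (tree_cod_cvg cw) => // s ts.
  by apply: tA; exists s.
Qed.

Variables d1 d2 : nat.
Variables (O1 : set 'rV[R]_d1) (O2 : set 'rV[R]_d2).
Hypotheses (cO1 : compact O1) (cO2 : compact O2).
Local Notation K := (rv_prod O1 O2).

Theorem approximate_competitor (c : 'rV[R]_(d1 + d2) -> R)
    (P_ : nat -> probability 'rV[R]_d1 R) (P : probability 'rV[R]_d1 R)
    (phi : probability 'rV[R]_(d1 + d2) R) (e : R) :
  bcont c -> 0 < e -> (forall k, P_ k (~` O1) = 0%E) ->
  (forall f, bcont f -> \int[P_ k]_x f x @[k --> \oo] --> \int[P]_x f x) ->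
  phi (~` K) = 0%E ->
  (forall A, measurable A -> phi (@lsubmx R 1 d1 d2 @^-1` A) = P A) ->
  \forall k \near \oo, exists phik : probability 'rV[R]_(d1 + d2) R,
    [/\ phik (~` K) = 0%E,
        forall A, measurable A -> phik (@lsubmx R 1 d1 d2 @^-1` A) = P_ k A,
        forall A, measurable A -> phik (@rsubmx R 1 d1 d2 @^-1` A) =
                                  phi (@rsubmx R 1 d1 d2 @^-1` A) &
        \int[phik]_x c x <= \int[phi]_x c x + e].
Proof.
move=> bc e0 PO1 cP phiK phiP; have cK := compact_rv_prod cO1 cO2.
have [cc [M cM]] := bc.
have e20 : 0 < e / 2 by rewrite divr_gt0.
have [r r0 rP] := compact_uniform cK cc e20.
(* Four displacements lead from [Y k t] to the first block of [X t]: to a point of its cylinder, to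
   the centre of a common ball, to a point of the other cylinder, and to the target. *)
have r40 : 0 < r / 4 by rewrite divr_gt0.
have mnorm (y : 'rV[R]_d1) := continuous_measurable_fun_rV (@dist_continuous R d1 y).
have /choice[rad radP] (y : 'rV[R]_d1) :
    exists s, 0 < s < r / 4 /\ P [set x | `|y - x| = s] = 0%E.
  by have [s s0 Ps] := null_level_set P (mnorm y) r40; exists s.
have [ctr ctrP] := compact_ball_cover cO1 (fun y => proj1 (andP (proj1 (radP y)))).
pose N := size ctr.
pose b i (x : 'rV[R]_d1) : bool := `|nth 0 ctr i - x| < rad (nth 0 ctr i).
have mb i : measurable [set x | b i x] by exact: measurable_ball_rV.
have cb i : continuity_set P [set x | b i x].
  by apply: continuity_set_ball; have [] := radP (nth 0 ctr i).
have [h1 mh1 rh1] := exists_resolving cO1.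
have [hK mhK rhK] := exists_resolving cK.
pose G i x := if (i < N)%N then b i x else h1 (i - N)%N x.
pose H i (x : 'rV[R]_(d1 + d2)) := if (i < N)%N then b i (lsubmx x) else hK (i - N)%N x.
have mG i : measurable [set x | G i x] by rewrite /G; case: (i < N)%N.
have mH i : measurable [set x | H i x].
  rewrite /H; case: (i < N)%N => //.
  rewrite -[X in measurable X]setTI.
  by apply: (measurable_lsubmx measurableT (mb i)).
have rG : resolving G O1 by exact: resolving_prepend.
have rH : resolving H K by exact: resolving_prepend.
pose w := cylinder_weight H phi.
pose w_ k := cylinder_weight G (P_ k).
have HG s : (size s <= N)%N ->
    [set x | bitcode H (size s) x = s] =
    @lsubmx R 1 d1 d2 @^-1` [set x | bitcode G (size s) x = s].
  move=> sN; have E x : bitcode H (size s) x = bitcode G (size s) (lsubmx x).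
    apply/eq_in_map => i; rewrite mem_iota add0n => /= il.
    by rewrite /H /G (leq_trans il sN).
  by apply/seteqP; split => x /=; rewrite E.
(* By [HG], a short word has under [phi] the mass given by the marginal [P], and its tests are balls
   with [P]-null spheres. The later tests come without such control, so convergence is claimed up to
   length [N] only. *)
have cw s : (size s <= N)%N -> w_ k s @[k --> \oo] --> w s.
  move=> sN; rewrite /w /cylinder_weight HG// phiP; last exact: measurable_bitcode.
  apply: continuity_set_cvg cP _; apply: continuity_set_bitcode => i iN.
  by rewrite /G (leq_trans iN sN).
have [X [XK XP]] := skorokhod cK rH (cylinder_weight_tree mH phi)
  (fun s => cylinder_weight_gt0 cK mH phiK).
have lawX := skorokhod_law cK mH rH phiK XP.
have /choice[Y YP] k := skorokhod cO1 rG (cylinder_weight_tree mG (P_ k))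
  (fun s => cylinder_weight_gt0 cO1 mG (PO1 k)).
have lawY k := skorokhod_law cO1 mG rG (PO1 k) (proj2 (YP k)).
have mX : measurable_fun setT X by exact: measurable_funP.
have mY k : measurable_fun setT (Y k) by exact: measurable_funP.
have mrX : measurable_fun setT (fun t => rsubmx (X t) : 'rV[R]_d2).
  by apply: measurableT_comp mX; exact: measurable_rsubmx.
have mrow k : measurable_fun setT (fun t => row_mx (Y k t) (rsubmx (X t)) : 'rV[R]_(d1 + d2)).
  exact: measurable_row_mx.
have /choice[Z ZE] k := exists_mfun (mrow k).
pose f k t : R := c (Z k t) - c (X t).
(* The excess of the cost difference over [e / 2]. It is bounded and eventually 0 for almost every
   [t], so its integral tends to 0, although [f k] itself need not converge. *)
pose F k t : R := Num.max (f k t - e / 2) 0.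
have near_close t k : 0 <= t < 1 -> tree_cod (w_ k) t N = tree_cod w t N ->
    f k t <= e / 2.
  move=> t01 codE.
  have sN := size_tree_cod w t N; set s := tree_cod w t N in codE sN.
  (* [X t] and [Y k t] are only in closures of cylinders, so the bits are read at nearby points [y]
     and [y'] of the cylinders themselves. *)
  have [y [[Ky ys] /= Xy]] := XP t N t01 _ (nbhs_ball_rV (X t) r40).
  have [y' [[Oy' ys'] /= Yy']] := proj2 (YP k) t N t01 _ (nbhs_ball_rV (Y k t) r40).
  rewrite -/w -/s sN in ys; rewrite -/(w_ k) codE sN in ys'.
  (* A ball of the cover that contains the first block of [y]. Its test is among the first [N] bits,
     so the equal code of [y'] puts [y'] in the same ball. *)
  have [z zc zy] := ctrP _ (proj1 Ky).
  have jN : (index z ctr < N)%N by rewrite index_mem.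
  have zy' : `|z - y'| < rad z.
    have := congr1 (nth false ^~ (index z ctr)) (etrans ys (esym ys')).
    by rewrite /= !nth_mkseq// /H /G jN /b nth_index// zy => /esym.
  have zr : rad z < r / 4 by have [/andP[]] := radP z.
  have h : `|Y k t - lsubmx (X t)| < r.
    have -> : Y k t - lsubmx (X t) = ((Y k t - y') + - (z - y')) +
        ((z - lsubmx y) + (lsubmx y - lsubmx (X t))).
      by rewrite (opprB z) !subrKA.
    apply: (le_lt_trans (ler_normD _ _)).
    have n1 := ler_normD (Y k t - y') (- (z - y')).
    have n2 := ler_normD (z - lsubmx y) (lsubmx y - lsubmx (X t)).
    rewrite normrN in n1.
    have n3 := lsubmx_norm_le y (X t); rewrite (distrC y) in n3.
    rewrite /ball_/= in Xy Yy'; lra.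
  have := rP _ _ (XK t) (norm_row_mx_sub r0 h).
  rewrite /f ZE distrC => /ltW; exact: le_trans (ler_norm _).
have mF k : measurable_fun setT (F k : measurableTypeR R -> R).
  apply: measurable_maxr; last exact: measurable_cst.
  apply: measurable_funB; last exact: measurable_cst.
  apply: measurable_funB.
    by apply: (measurableT_comp (continuous_measurable_fun_rV cc)); exact: measurable_funP.
  by apply: (measurableT_comp (continuous_measurable_fun_rV cc)); exact: measurable_funP.
have FM k t : `|F k t| <= 2 * M.
  have bound (x y : R) : `|x| <= M -> `|y| <= M -> `|Num.max (x - y - e / 2) 0| <= 2 * M.
    rewrite !ler_norml => /andP[? ?] /andP[? ?].
    by case: (leP (x - y - e / 2) 0) => ?; apply/andP; split; lra.
  exact: bound.
have cF : \int[unit_prob R]_t F k t @[k --> \oo] --> \int[unit_prob R]_t (fun=> 0) t.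
  apply: (@bounded_cvg_Rintegral _ _ _ _ _ _ (2 * M)) => //.
  have [N0 [mN0 N00 subN0]] := ae_tree_cod_cvg cw; exists N0; split => //.
  apply: subset_trans subN0; apply: subsetC => t [t01 tk] /=.
  apply: cvg_near_cst; apply: filterS tk => k /(near_close t k t01).
  by rewrite /F => ?; apply/max_idPr; rewrite subr_le0.
rewrite Rintegral_cst// mul0r in cF.
have icZ k : (unit_prob R).-integrable setT (EFin \o (fun t => c (Z k t))).
  exact: (@bcont_integrable _ _ _ _ (unit_prob R) (Z k)).
have icX : (unit_prob R).-integrable setT (EFin \o (fun t => c (X t))).
  exact: (@bcont_integrable _ _ _ _ (unit_prob R) X).
have near_F : \forall k \near \oo, \int[unit_prob R]_t F k t < e / 2.
  exact: cvgr_lt _ cF _ e20.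
have [k0 _ k0P] := near_F; exists k0 => // k /= /k0P /= Fk.
exists (distribution (unit_prob R) (Z k)); split.
- transitivity (unit_prob R (Z k @^-1` (~` K))); first by [].
  rewrite (_ : _ @^-1` _ = set0) ?measure0// -subset0 => t /=; apply.
  rewrite ZE; split; first by rewrite row_mxKl; exact: (proj1 (YP k)).
  by rewrite row_mxKr; have [] := XK t.
- move=> A mA; rewrite -lawY//.
  transitivity (unit_prob R (Z k @^-1` (@lsubmx R 1 d1 d2 @^-1` A))); first by [].
  transitivity (unit_prob R (Y k @^-1` A)); last by [].
  by congr (unit_prob R _); apply/seteqP; split => t /=; rewrite ZE row_mxKl.
- move=> A mA; rewrite -lawX; last first.
    by rewrite -[X in measurable X]setTI; exact: measurable_rsubmx.
  transitivity (unit_prob R (Z k @^-1` (@rsubmx R 1 d1 d2 @^-1` A))); first by [].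
  transitivity (unit_prob R (X @^-1` (@rsubmx R 1 d1 d2 @^-1` A))); last by [].
  by congr (unit_prob R _); apply/seteqP; split => t /=; rewrite ZE row_mxKr.
- have -> : \int[phi]_x c x = \int[distribution (unit_prob R) X]_x c x.
    congr fine; apply: eq_measure_integral => A mA _.
    exact: esym (lawX A mA).
  rewrite !Rintegral_distribution// -lerBlDl -RintegralB//.
  have iF : (unit_prob R).-integrable setT (EFin \o F k) by exact: bounded_integrable.
  have iF2 : (unit_prob R).-integrable setT (EFin \o (fun t => F k t + e / 2)).
    apply: (@bounded_integrable _ _ _ _ _ (2 * M + e / 2)).
      by apply: measurable_funD => //; exact: measurable_cst.
    move=> t; rewrite (le_trans (ler_normD _ _))// lerD//.
    by rewrite ger0_norm// ltW.
  have ie : (unit_prob R).-integrable setT (EFin \o cst (e / 2)).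
    exact: (@finite_measure_integrable_cst _ _ _ (unit_prob R) setT _ measurableT).
  have iB : (unit_prob R).-integrable setT (EFin \o (fun t => c (Z k t) - c (X t))).
    rewrite (_ : _ \o _ = (EFin \o (fun t => c (Z k t))) \- (EFin \o (fun t => c (X t))))%E//.
    exact: integrableB.
  apply: (@le_trans _ _ (\int[unit_prob R]_t (F k t + e / 2))).
    apply: le_Rintegral => // t _.
    by rewrite -lerBlDr /F le_max lexx.
  rewrite RintegralD// Rintegral_cst//= probability_setT mulr1.
  by rewrite [leRHS]splitr lerD2r ltW.
Qed.

End approximate_competitor.

(** * The bilevel problem *)

Lemma le_measure_null d (T : measurableType d) (R : realType)
    (mu : {measure set T -> \bar R}) (A B N : set T) :
  measurable A -> measurable B -> measurable N -> mu N = 0%E ->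
  A `<=` B `|` N -> (mu A <= mu B)%E.
Proof.
move=> mA mB mN N0 AB; rewrite -[leRHS]adde0 -N0.
apply: le_trans (measureU2 mu mB mN); apply: le_measure; rewrite ?inE//.
exact: measurableU.
Qed.

Lemma eq_Rintegral_measure (R : realType) n (P Q : probability 'rV[R]_n R)
    (D : set 'rV[R]_n) (f : 'rV[R]_n -> R) :
  (forall A, measurable A -> P A = Q A) ->
  \int[P]_(x in D) f x = \int[Q]_(x in D) f x.
Proof. by move=> PQ; congr fine; apply: eq_measure_integral => A mA _; exact: PQ. Qed.

Section bilevel.
Variables (R : realType) (d1 d2 : nat).
Variables (O1 : set 'rV[R]_d1) (O2 : set 'rV[R]_d2).
Hypotheses (cO1 : compact O1) (cO2 : compact O2).
Local Notation K := (rv_prod O1 O2).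
Local Notation lsub := (@lsubmx R 1 d1 d2).
Local Notation rsub := (@rsubmx R 1 d1 d2).

Let cK : compact K. Proof. exact: compact_rv_prod. Qed.
Let mK : measurable K. Proof. exact: compact_measurable_rV. Qed.
Let mO1 : measurable O1. Proof. exact: compact_measurable_rV. Qed.

Let mlsub A : measurable A -> measurable (lsub @^-1` A).
Proof. by move=> mA; rewrite -[X in measurable X]setTI; exact: measurable_lsubmx. Qed.

Let mrsub A : measurable A -> measurable (rsub @^-1` A).
Proof. by move=> mA; rewrite -[X in measurable X]setTI; exact: measurable_rsubmx. Qed.

Definition marginals (P : probability 'rV[R]_(d1 + d2) R)
    (Q : probability 'rV[R]_d1 R) (Q2 : probability 'rV[R]_d2 R) :=
  (forall A, measurable A -> P (lsub @^-1` A) = Q A) /\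
  (forall A, measurable A -> P (rsub @^-1` A) = Q2 A).

Lemma marginals_Rintegral1 P Q Q2 f : marginals P Q Q2 -> bcont f ->
  \int[Q]_x f x = \int[P]_x f (lsub x).
Proof.
move=> [PQ _] bf; have [L LE] := exists_mfun (@measurable_lsubmx R d1 d2).
rewrite -(@eq_Rintegral_measure _ _ (distribution P L)).
  by rewrite Rintegral_distribution// LE.
move=> A mA; transitivity (P (L @^-1` A)); first by [].
by rewrite LE; exact: PQ.
Qed.

Lemma marginals_Rintegral2 P Q Q2 f : marginals P Q Q2 -> bcont f ->
  \int[Q2]_x f x = \int[P]_x f (rsub x).
Proof.
move=> [_ PQ] bf; have [L LE] := exists_mfun (@measurable_rsubmx R d1 d2).
rewrite -(@eq_Rintegral_measure _ _ (distribution P L)).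
  by rewrite Rintegral_distribution// LE.
move=> A mA; transitivity (P (L @^-1` A)); first by [].
by rewrite LE; exact: PQ.
Qed.

Variables (mu2 : signed_measure O2) (Q2 : probability 'rV[R]_d2 R).
Hypothesis mu2Q2 : represents mu2 Q2.

Lemma nonneg_plansP (mu : signed_measure O1) Q (pi : signed_measure K) :
  represents mu Q -> nonneg_plans mu mu2 pi <->
  exists2 P, represents pi P & marginals P Q Q2.
Proof.
move=> muQ; split=> [[[pi1 pi2] pi0]|[P piP [P1 P2]]].
  have [|P piP] := @nonneg_represents R _ K pi pi0.
    have := pi1 setT measurableT; rewrite /pushforward preimage_setT => ->.
    by rewrite muQ// probability_setT.
  exists P => //; split=> A mA.
    by rewrite -muQ// -pi1//; exact: esym (piP _ (mlsub mA)).
  by rewrite -mu2Q2// -pi2//; exact: esym (piP _ (mrsub mA)).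
split; last exact: represents_nonneg piP.
split=> A mA; rewrite /pushforward piP.
- by rewrite P1// muQ.
- exact: mlsub.
- by rewrite P2// mu2Q2.
- exact: mrsub.
Qed.

Variable c : 'rV[R]_(d1 + d2) -> R.

(** For a Dirac mass at [x1] the lower-level problem has a single admissible plan: every plan is
    concentrated on the fibre over [x1], where its second marginal determines it. Optimality is then
    immediate. *)
Lemma bilevel_feasible_exists : O1 !=set0 ->
  exists pm : signed_measure K * signed_measure O1, bilevel_feasible c mu2 pm.
Proof.
move=> [x1 Ox1].
pose Q : probability 'rV[R]_d1 R := dirac x1.
have QO1 : Q (~` O1) = 0%E by rewrite /Q/= diracE memNset//=; apply.
have [mu muQ] := represented cO1 QO1.
have mrow : measurable_fun setT (fun y => row_mx x1 y : 'rV[R]_(d1 + d2)).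
  by apply: measurable_row_mx; [exact: measurable_cst|exact: measurable_id].
have [r rE] := exists_mfun mrow.
pose P : probability 'rV[R]_(d1 + d2) R := distribution Q2 r.
have PE A : P A = Q2 (r @^-1` A) by [].
have Q2O2 := represents_carried (compact_measurable_rV cO2) mu2Q2.
have PK : P (~` K) = 0%E.
  rewrite PE (_ : r @^-1` _ = ~` O2)//; apply/seteqP; split => y /=; rewrite rE.
    by move=> nK Oy; apply: nK; split; rewrite ?row_mxKl ?row_mxKr.
  by move=> nO [_]; rewrite row_mxKr.
have [pi piP] := represented cK PK.
have margP : marginals P Q Q2.
  split=> A mA; rewrite PE.
    rewrite /Q/= diracE; have [xA|xA] := boolP (x1 \in A).
      rewrite (_ : r @^-1` _ = setT) ?probability_setT//.
      by apply/seteqP; split => // y _ /=; rewrite rE row_mxKl; exact/set_mem.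
    rewrite (_ : r @^-1` _ = set0) ?measure0//.
    rewrite -subset0 => y /=; rewrite rE row_mxKl => /mem_set.
    by rewrite (negbTE xA).
  by congr (Q2 _); apply/seteqP; split => y /=; rewrite rE row_mxKr.
exists (pi, mu); split => /=.
- exact: represents_nonneg muQ.
- by have := represents_tv_norm mO1 muQ.
split; first by apply/(nonneg_plansP _ muQ); exists P.
move=> phi /(nonneg_plansP _ muQ)[P' phiP' [P1 P2]].
rewrite (integral_on_represents _ piP) (integral_on_represents _ phiP').
suff PP' A : measurable A -> P A = P' A by rewrite (eq_Rintegral_measure _ _ PP').
move=> mA; pose N := lsub @^-1` (~` [set x1]).
have mx1 : measurable (~` [set x1]).
  by apply: measurableC; apply: compact_measurable_rV; exact: compact_set1.
have N0 : P' N = 0%E by rewrite P1// /Q/= diracE memNset//=; apply.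
have mB : measurable (r @^-1` A) by rewrite -[X in measurable X]setTI; apply: measurable_funP.
rewrite PE -P2//; apply/eqP; rewrite eq_le; apply/andP; split.
  apply: (@le_measure_null _ _ _ P' _ _ N) => //; [exact: mrsub|exact: mlsub|].
  move=> x /=; rewrite rE; have [xx1|] := pselect (lsub x = x1); last by right.
  by rewrite -xx1 hsubmxK; left.
apply: (@le_measure_null _ _ _ P' _ _ N) => //; [exact: mrsub|exact: mlsub|].
move=> x Ax /=; rewrite rE; have [xx1|] := pselect (lsub x = x1); last by right.
by left; rewrite -xx1 hsubmxK.
Qed.

Hypothesis c_cont : {within K, continuous c}.

(** Weak-* sequential compactness of the feasible set, which is what the direct method needs besides
    lower semicontinuity. *)
Theorem bilevel_closed (pm_ : nat -> signed_measure K * signed_measure O1) :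
  (forall k, bilevel_feasible c mu2 (pm_ k)) ->
  exists2 f : nat -> nat, {homo f : i j / (i < j)%N} &
  exists2 pm, bilevel_feasible c mu2 pm &
    weak_star_cvg (fun k => (pm_ (f k)).1) pm.1 /\
    weak_star_cvg (fun k => (pm_ (f k)).2) pm.2.
Proof.
move=> feas.
have /choice[PQ PQP] k : exists PQ : probability 'rV[R]_(d1 + d2) R * probability 'rV[R]_d1 R,
    [/\ represents (pm_ k).1 PQ.1, represents (pm_ k).2 PQ.2 & marginals PQ.1 PQ.2 Q2].
  have [mu0 mu1 [plan _]] := feas k.
  have [Q muQ] := tv_norm_represents mO1 mu0 mu1.
  by have [P piP margP] := proj1 (nonneg_plansP _ muQ) plan; exists (P, Q).
have PK k : (PQ k).1 (~` K) = 0%E.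
  by have [piP _ _] := PQP k; have := represents_carried mK piP.
have [f homo_f [P PK0 cP]] := probability_subsequence cK PK.
have [L LE] := exists_mfun (@measurable_lsubmx R d1 d2).
(* No second extraction is made for the measures on [O1]: their limit is the first marginal of the
   limit plan, by testing with [g \o lsub]. *)
pose Q : probability 'rV[R]_d1 R := distribution P L.
have PQE A : measurable A -> P (lsub @^-1` A) = Q A.
  by move=> mA; rewrite -LE.
have QO1 : Q (~` O1) = 0%E.
  rewrite -PQE; last exact: measurableC.
  apply: subset_measure0 PK0; [|exact: measurableC|].
    by apply: mlsub; exact: measurableC.
  by move=> x /= nO1 [].
have [pi piP] := represented cK PK0; have [mu muQ] := represented cO1 QO1.
have margP : marginals P Q Q2.
  split=> // A mA; have [L2 LE2] := exists_mfun (@measurable_rsubmx R d1 d2).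
  transitivity (distribution P L2 A); first by rewrite -LE2.
  apply: probability_rV_unique mA => g bg.
  rewrite Rintegral_distribution// LE2.
  have bgr : bcont (g \o rsub) by apply: bcont_comp => //; exact: continuous_rsubmx.
  (* All the plans have second marginal [Q2], so their integrals of [g \o rsub] form a constant
     sequence. *)
  apply: (cvg_unique _ (cP _ bgr)) => //.
  rewrite (_ : (fun k => _) = fun=> \int[Q2]_x g x); first exact: cvg_cst.
  by apply/funext => k; have [_ _ m] := PQP (f k); rewrite (marginals_Rintegral2 m bg).
have cQ g : bcont g -> \int[(PQ (f k)).2]_x g x @[k --> \oo] --> \int[Q]_x g x.
  move=> bg; rewrite (marginals_Rintegral1 margP bg).
  rewrite (_ : (fun k => _) = fun k => \int[(PQ (f k)).1]_x g (lsub x)).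
    by apply: (cP (g \o lsub)); apply: bcont_comp => //; exact: continuous_lsubmx.
  by apply/funext => k; have [_ _ m] := PQP (f k); rewrite (marginals_Rintegral1 m bg).
(* The approximation of competitors works with a cost on the whole space; measures carried by [K] do
   not see how it is extended. *)
have [cb bcb ccb] := bcont_extension cK c_cont.
have optimal phi : nonneg_plans mu mu2 phi -> integral_on pi c <= integral_on phi c.
  move=> /(nonneg_plansP _ muQ)[P' phiP' [P1 P2]].
  rewrite (integral_on_bcont mK piP bcb ccb) (integral_on_bcont mK phiP' bcb ccb).
  apply/ler_addgt0Pr => e e0.
  have QkO1 k : (PQ (f k)).2 (~` O1) = 0%E.
    by have [_ muQk _] := PQP (f k); have := represents_carried mO1 muQk.
  have near_comp := approximate_competitor cO1 cO2 bcb e0 QkO1 cQ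
    (represents_carried mK phiP') P1.
  rewrite -(cvg_lim (@Rhausdorff R) (cP _ bcb)).
  apply: limr_le; first exact: cvgP (cP _ bcb).
  apply: filterS near_comp => k [Pk [PkK Pk1 Pk2 Pkc]].
  have [piQ muQk _] := PQP (f k).
  have [psi psiP] := represented cK PkK.
  have [_ _ [_ opt]] := feas (f k).
  have plan : nonneg_plans (pm_ (f k)).2 mu2 psi.
    apply/(nonneg_plansP _ muQk); exists Pk => //; split => // A mA.
    by rewrite Pk2// P2.
  have := opt _ plan.
  rewrite (integral_on_bcont mK piQ bcb ccb) (integral_on_bcont mK psiP bcb ccb).
  by move=> /le_trans; apply.
exists f => //; exists (pi, mu).
  split=> /=; [exact: represents_nonneg muQ|by have := represents_tv_norm mO1 muQ|].
  by split => //; apply/(nonneg_plansP _ muQ); exists P.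
split=> g /= cg.
  have [gb bgb ggb] := bcont_extension cK cg.
  rewrite (integral_on_bcont mK piP bgb ggb).
  rewrite (_ : (fun k => _) = fun k => \int[(PQ (f k)).1]_x gb x); first exact: cP.
  apply/funext => k; have [piQ _ _] := PQP (f k).
  exact: (integral_on_bcont mK piQ bgb ggb).
have [gb bgb ggb] := bcont_extension cO1 cg.
rewrite (integral_on_bcont mO1 muQ bgb ggb).
rewrite (_ : (fun k => _) = fun k => \int[(PQ (f k)).2]_x gb x); first exact: cQ.
apply/funext => k; have [_ muQk _] := PQP (f k).
exact: (integral_on_bcont mO1 muQk bgb ggb).
Qed.

End bilevel.

Theorem theorem3p2 (R : realType) (d1 d2 : nat)
  (O1 : set 'rV[R]_d1) (O2 : set 'rV[R]_d2)
  (cptO1 : compact O1) (cnO1 : connected O1) (intO1 : interior O1 !=set0)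
  (cptO2 : compact O2) (cnO2 : connected O2) (intO2 : interior O2 !=set0)
  (O_closure : rv_prod O1 O2 = closure (interior (rv_prod O1 O2)))
  (O_lipschitz : has_lipschitz_boundary (rv_prod O1 O2))
  (mu2 : signed_measure O2) (mu2_ge0 : nonneg mu2) (mu2_norm : tv_norm mu2 = 1%E)
  (p : \bar R) (p_gt : (((d1 + d2)%:R)%:E < p)%E)
  (c : 'rV[R]_(d1 + d2) -> R)
  (c_sobolev : sobolev1 p (interior (rv_prod O1 O2)) c)
  (c_cont : {within rv_prod O1 O2, continuous c})
  (J : signed_measure (rv_prod O1 O2) -> signed_measure O1 -> R)
  (J_lsc : weak_star_lsc J) :
  exists2 pm : signed_measure (rv_prod O1 O2) * signed_measure O1,
    bilevel_feasible c mu2 pm &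
    forall pm', bilevel_feasible c mu2 pm' -> J pm.1 pm.2 <= J pm'.1 pm'.2.
Proof.
have [Q2 mu2Q2] := tv_norm_represents (compact_measurable_rV cptO2) mu2_ge0 mu2_norm.
have [x1 /interior_subset Ox1] := intO1.
have [pm0 feas0] := bilevel_feasible_exists cptO1 cptO2 mu2Q2 c (ex_intro _ x1 Ox1).
(* The infimum is taken in the extended reals, since nothing says beforehand that [J] is bounded
   below on feasible pairs; that it is attained rules out [-oo]. *)
pose S := [set (J pm.1 pm.2)%:E | pm in bilevel_feasible c mu2].
have S0 : S != set0 by apply/set0P; exists (J pm0.1 pm0.2)%:E; exists pm0.
have [u Su cu] := ereal_inf_seq S0.
have /choice[pm_ pmP] k : exists pm, bilevel_feasible c mu2 pm /\ (J pm.1 pm.2)%:E = u k.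
  by have [pm ? ?] := Su k; exists pm.
have [f homo_f [pm feas [cpi cmu]]] :=
  bilevel_closed cptO1 cptO2 mu2Q2 c_cont (fun k => proj1 (pmP k)).
exists pm => // pm' feas'; rewrite -lee_fin.
apply: (@le_trans _ _ (ereal_inf S)); last by apply: ereal_inf_lbound; exists pm'.
have cf : f @ \oo --> \oo.
  move=> A [N _ NA]; exists N => // k /= Nk; apply: NA => /=; apply: (leq_trans Nk).
  by elim: k {Nk} => // k /leq_ltn_trans; apply; exact: homo_f.
have cuf : (u \o f) @ \oo --> ereal_inf S by exact: cvg_comp cf cu.
(* The infimum is the limit of the values along the subsequence, hence their lower limit, which is
   the quantity that [J_lsc] compares with the value at [pm]. *)
rewrite -(cvg_lim (@ereal_hausdorff R) cuf) -is_cvg_limn_einfE; last exact: cvgP cuf.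
rewrite (_ : u \o f = fun k => (J (pm_ (f k)).1 (pm_ (f k)).2)%:E); first exact: J_lsc.
by apply/funext => k /=; have [_ ->] := pmP (f k).
Qed.
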